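(* Let $T_0$ be a self-adjoint operator on $\mathcal{H}$, let $s_n$ ($n\in\mathbb{N}$) be self-adjoint operators on $\mathcal{H}$ such that $s_n\to I$ strongly as $n\to\infty$ and $\|s_n\|\le C$ for some $C>0$ independent of $n$, let $\gamma>0$, and let $T_n=T_0+i\gamma s_n$ with $D(T_n)=D(T_0)$ and $T=T_0+i\gamma$. Suppose that at least one of the following holds: (1) $s_n$ is a projection operator, that is $s_n^2=s_n$, for all $n$; (2) for every sequence $(u_n)\subset D(T_0)$ which is bounded in $\mathcal{H}$ and for which $(T_0u_n)$ is bounded in $\mathcal{H}$, one has $\langle s_nu_n,T_0u_n\rangle-\langle T_0u_n,s_nu_n\rangle\to0$ as $n\to\infty$. Then for any $\lambda\in\sigma_d(T)$, $(T_n)$ is spectrally exact for $T$ in some open neighbourhood of $\lambda$ in $\mathbb{C}$.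
   Context: $\mathcal{H}$ is a separable Hilbert space with inner product $\langle\cdot,\cdot\rangle$ and norm $\|\cdot\|$. The essential spectrum of an operator $H$ on $\mathcal{H}$ is $\sigma_e(H)=\{\lambda\in\mathbb{C}:\exists (u_n)\subset D(H)\text{ with }\|u_n\|=1,\ u_n\rightharpoonup0,\ \|(H-\lambda)u_n\|\to0\}$, and the discrete spectrum is $\sigma_d(H)=\sigma(H)\setminus\sigma_e(H)$. For a sequence of operators $(H_n)$, the limiting spectrum is $\sigma((H_n))=\{\lambda\in\mathbb{C}:\exists I\subset\mathbb{N}\text{ infinite},\ \exists\lambda_n\in\sigma(H_n),\ n\in I,\text{ with }\lambda_n\to\lambda\}$, and the set of spectral pollution with respect to $H$ is $\sigma_{\rm poll}((H_n))=\{\lambda\in\sigma((H_n)):\lambda\notin\sigma(H)\}$. $(H_n)$ is spectrally exact for $H$ in $\Omega\subset\mathbb{C}$ if $\sigma(H)\cap\Omega\subset\sigma((H_n))$ and $\sigma_{\rm poll}((H_n))\cap\Omega=\emptyset$. *)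

(* Defs.v *)
From HB Require Import structures.
From mathcomp Require Import all_boot all_order all_algebra.
From mathcomp Require Import complex.
From mathcomp Require Import all_classical all_reals all_analysis.

Set Implicit Arguments.
Unset Strict Implicit.
Unset Printing Implicit Defensive.

Import Order.TTheory GRing.Theory Num.Theory.
Import numFieldNormedType.Exports.

Local Open Scope classical_set_scope.
Local Open Scope ring_scope.
Local Open Scope complex_scope.

(* R[i] with the topology of its modulus; the library only provides it on the
   alias R[i]^o, which the instance search does not see through. *)
HB.instance Definition _ (R : realType) := NormedModule.copy R[i] R[i]^o.

(* The inner product is linear in its first argument and conjugate-linear in
   the second one. Norms take their values in R[i], as for every normedModType
   over R[i]. *)
HB.mixin Record isHilbert (R : realType) H of CompleteNormedModule R[i] H := {
  inner : {dot H for Num.Def.conjC};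
  innerxx : forall u : H, inner u u = `|u| ^+ 2
}.

#[short(type="hilbertType")]
HB.structure Definition Hilbert (R : realType) :=
  { H of isHilbert R H & CompleteNormedModule R[i] H }.

Notation "'[< u , v >]" := (inner u v)
  (at level 2, u, v at level 200) : ring_scope.

Definition separable (T : topologicalType) :=
  exists2 S : set T, countable S & dense S.

(* A linear operator defined on the subspace dom; the values of op outside dom
   are junk and no definition below looks at them. *)
Record operator (R : realType) (H : hilbertType R) := Operator {
  dom : set H;
  op :> H -> H;
  dom0 : dom 0;
  dom_linear : forall (a : R[i]) u v, dom u -> dom v -> dom (a *: u + v);
  op_linear : forall (a : R[i]) u v, dom u -> dom v ->
    op (a *: u + v) = a *: op u + op v
}.

Section Operators.
Context {R : realType} {H : hilbertType R}.
Implicit Types (A : operator H) (B : {linear H -> H}) (u v w : H) (l : R[i]).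

Definition everywhere B : operator H :=
  @Operator R H setT B I (fun _ _ _ _ _ => I) (fun a u v _ _ => linearP B a u v).

Fact op_add_linear A B (a : R[i]) u v : dom A u -> dom A v ->
  A (a *: u + v) + B (a *: u + v) = a *: (A u + B u) + (A v + B v).
Proof. by move=> Au Av; rewrite op_linear// linearP scalerDr addrACA. Qed.

(* B is defined everywhere, so the natural domain of A + B is dom A. *)
Definition op_add A B : operator H :=
  Operator (dom0 A) (@dom_linear _ _ A) (@op_add_linear A B).

(* The pairs (v, A^* v), v in the domain of the adjoint of A; this is the graph
   of a function only when dom A is dense. *)
Definition adjoint_graph A : set (H * H) :=
  [set vw | forall u, dom A u -> '[< A u, vw.1 >] = '[< u, vw.2 >]].

Definition self_adjoint A :=
  dense (dom A) /\
  adjoint_graph A = [set vw | dom A vw.1 /\ vw.2 = A vw.1].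

Definition resolvent_set A : set R[i] :=
  [set l | exists B, [/\ continuous B,
     forall v, dom A (B v) /\ A (B v) - l *: B v = v &
     forall u, dom A u -> B (A u - l *: u) = u]].

Definition spectrum A : set R[i] := ~` resolvent_set A.

Definition weakly_cvg (u : nat -> H) (u0 : H) :=
  forall v, '[< u n, v >] @[n --> \oo] --> '[< u0, v >].

Definition essential_spectrum A : set R[i] :=
  [set l | exists u : nat -> H,
     [/\ forall n, dom A (u n), forall n, `|u n| = 1, weakly_cvg u 0 &
         `|A (u n) - l *: u n| @[n --> \oo] --> (0 : R[i])]].

Definition discrete_spectrum A : set R[i] :=
  spectrum A `\` essential_spectrum A.

(* The values of ln outside I are irrelevant. *)
Definition limiting_spectrum (An : nat -> operator H) : set R[i] :=
  [set l | exists I : set nat, infinite_set I /\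
     exists ln : nat -> R[i], (forall n, I n -> spectrum (An n) (ln n)) /\
       ln n @[n --> within I \oo] --> l].

Definition spectral_pollution (An : nat -> operator H) A : set R[i] :=
  limiting_spectrum An `\` spectrum A.

Definition spectrally_exact (An : nat -> operator H) A (Omega : set R[i]) :=
  spectrum A `&` Omega `<=` limiting_spectrum An /\
  spectral_pollution An A `&` Omega = set0.

End Operators.

(* Main.v *)
Require Import Defs.
From HB Require Import structures.
From mathcomp Require Import all_boot all_order all_algebra.
From mathcomp Require Import complex.
From mathcomp Require Import ring lra.
From mathcomp Require Import all_classical all_reals all_analysis.

Import Order.TTheory GRing.Theory Num.Theory.
Import numFieldNormedType.Exports.

Local Open Scope classical_set_scope.
Local Open Scope ring_scope.
Local Open Scope complex_scope.

(** Write [lam = mu + i gamma]. Since [T - lam] is the self-adjoint operator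
    [T0 - mu] and [lam] is in the spectrum but not in the essential spectrum of
    [T], Weyl sequences show that [N = ker (T0 - mu)] is nonzero and finite
    dimensional and that [T0 - mu] is bounded below on the orthogonal
    complement of [N] (discrete_eigenvalue, eigenspace_basis, eigenspace_gap).

    The theorem rests on a lower bound for [T_n - l] that is uniform in large
    [n] and in [l] in an annulus [eps <= |l - lam| <= r], where [r] does not
    depend on [eps] (lower_bound). Let [u] be a unit vector with
    [f = (T_n - l) u] small, that is
    [f = (T0 - mu) u + i gamma (s_n - 1) u + (lam - l) u]. The component of [u]
    along [N] is small: pair [f] with it and use that [s_n -> 1] uniformly on
    the finite-dimensional space [N]. The component orthogonal to [N] is
    controlled by [(T0 - mu) u], hence by the defect [u - s_n u]. The defect is
    small when [l] is close to [lam], because the imaginary part of [<f, u>]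
    forces [gamma <s_n u, u>] to be close to [Im l], which is close to [gamma];
    then [|u - s_n u|^2] is [1 - <s_n u, u>] when [s_n] is a projection, and in
    the other case the commutator hypothesis gives
    [gamma |s_n u|^2 = Im l <s_n u, u> + o(1)], so that [|u - s_n u|^2] is
    [(1 - Im l / gamma)^2 + o(1)] (defect_projection, defect_commutator).

    The adjoint of [T_n - l] has the same form with [- gamma] for [gamma], so
    it obeys the same bound and the annulus lies in the resolvent set of [T_n]
    (perturbed_resolvent). This excludes pollution in the disc of radius [r];
    letting [n] tend to infinity in the bound shows that [lam] is the only
    point of the spectrum of [T] in that disc.

    It remains to find spectrum of [T_n] near [lam]. If a small square around
    [lam] were in the resolvent set, apply the resolvent to
    [psi = (T_n - lam) phi], with [phi] a unit vector of [N]. The result is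
    [phi], of norm 1, at the centre, while on the boundary it is bounded by
    [|psi| / k], which tends to 0 because [psi = i gamma (s_n - 1) phi]. This
    contradicts the maximum principle for the norm of an analytic
    vector-valued function, which has an elementary proof for resolvents
    (resolvent_max_principle). *)

(** * Norms with values in the real numbers *)

(** The library norm of a normed module over [R[i]] is a nonnegative complex
    number; real estimates need it as an element of [R]. *)
Definition nrm {R : realType} {V : normedModType R[i]} (x : V) : R := complex.Re `|x|.

Section Norm.
Context {R : realType} {V : normedModType R[i]}.
Implicit Types (x y z : V).

Lemma nrmE x : `|x| = (nrm x)%:C.
Proof. by rewrite /nrm RRe_real. Qed.

Lemma nrm_ge0 x : 0 <= nrm x.
Proof. by rewrite -lecR -nrmE; exact: normr_ge0. Qed.

Lemma nrm0 : nrm (0 : V) = 0.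
Proof. by apply: complexI; rewrite -nrmE normr0. Qed.

Lemma nrm_eq0 x : nrm x = 0 -> x = 0.
Proof. by move=> x0; apply/normr0_eq0; rewrite nrmE x0. Qed.

Lemma nrm_gt0 x : x <> 0 -> 0 < nrm x.
Proof.
move=> x0; rewrite lt_neqAle nrm_ge0 andbT; apply/eqP => /esym/nrm_eq0.
exact: x0.
Qed.

Lemma nrmN x : nrm (- x) = nrm x.
Proof. by rewrite /nrm normrN. Qed.

Lemma nrmB x y : nrm (x - y) = nrm (y - x).
Proof. by rewrite /nrm distrC. Qed.

Lemma nrmD x y : nrm (x + y) <= nrm x + nrm y.
Proof. by rewrite -lecR rmorphD /= -!nrmE ler_normD. Qed.

Lemma nrm_sub x y : nrm (x - y) <= nrm x + nrm y.
Proof. by rewrite -(nrmN y) nrmD. Qed.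

Lemma nrm_tri z x y : nrm (x - y) <= nrm (x - z) + nrm (z - y).
Proof. by rewrite -[x - y](subrKA z) nrmD. Qed.

Lemma nrm_cvgP {T} (F : set_system T) (FF : Filter F) (f : T -> V) (l : V) :
  f @ F --> l <-> forall e : R, 0 < e -> \forall t \near F, nrm (l - f t) < e.
Proof.
split=> [/cvgrPdist_lt fl e e0|fl].
  have := fl e%:C; rewrite ltcR => /(_ e0); apply: filterS => t.
  by rewrite nrmE ltcR.
apply/cvgrPdist_lt => -[e i]; rewrite ltcE /= => /andP[/eqP -> e0].
by apply: filterS (fl e e0) => t; rewrite nrmE complexr0 ltcR.
Qed.

Lemma nrm_seqP (f : nat -> V) (l : V) :
  f n @[n --> \oo] --> l <->
  forall e : R, 0 < e -> exists N, forall n, (N <= n)%N -> nrm (l - f n) < e.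
Proof.
split => [/nrm_cvgP fl e /fl [N _ fN]|fl]; first by exists N => n /fN.
apply/nrm_cvgP => e /fl [N fN]; exists N => //= n; exact: fN.
Qed.

End Norm.

Lemma nrmZ {R : realType} {V : normedModType R[i]} (a : R[i]) (x : V) :
  nrm (a *: x) = nrm a * nrm x.
Proof. by apply: complexI; rewrite rmorphM /= -!nrmE normrZ. Qed.

Lemma nrmM {R : realType} (a b : R[i]) : nrm (a * b) = nrm a * nrm b.
Proof. exact: (nrmZ a (b : R[i]^o)). Qed.

Lemma nrm1 {R : realType} : nrm (1 : R[i]) = 1.
Proof. by apply: complexI; rewrite -nrmE normr1. Qed.

Lemma nrmX {R : realType} (a : R[i]) n : nrm (a ^+ n) = nrm a ^+ n.
Proof. by elim: n => [|n IH]; rewrite ?nrm1// !exprS nrmM IH. Qed.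

Lemma nrm_nat {R : realType} n : nrm (n%:R : R[i]) = n%:R.
Proof. by rewrite /nrm normr_nat -(rmorph_nat (real_complex R)). Qed.

Section Complex.
Context {R : realType}.
Implicit Types (z : R[i]) (x : R).

Lemma nrm_sqr z : nrm z ^+ 2 = complex.Re z ^+ 2 + complex.Im z ^+ 2.
Proof. by apply: complexI; rewrite add_Re2_Im2 nrmE rmorphXn. Qed.

Lemma nrm_real x : nrm (x%:C) = `|x|.
Proof. by rewrite /nrm normc_def /= expr0n addr0 sqrtr_sqr. Qed.

Lemma nrm_i : nrm ('i%C : R[i]) = 1.
Proof. by rewrite /nrm normc_def /= expr0n add0r expr1n sqrtr1. Qed.

Lemma nrm_conj z : nrm (z^*)%C = nrm z.
Proof. by rewrite /nrm !normc_def; case: z => a b /=; rewrite sqrrN. Qed.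

Lemma Re_le z : `|complex.Re z| <= nrm z.
Proof.
rewrite -(ler_pXn2r (ltn0Sn 1)) ?nnegrE ?nrm_ge0// nrm_sqr -normrX.
by rewrite ger0_norm ?sqr_ge0// lerDl sqr_ge0.
Qed.

Lemma Im_le z : `|complex.Im z| <= nrm z.
Proof.
rewrite -(ler_pXn2r (ltn0Sn 1)) ?nnegrE ?nrm_ge0// nrm_sqr -normrX.
by rewrite ger0_norm ?sqr_ge0// lerDr sqr_ge0.
Qed.

Lemma nrm_le_ReIm z : nrm z <= `|complex.Re z| + `|complex.Im z|.
Proof.
rewrite -(ler_pXn2r (ltn0Sn 1)) ?nnegrE ?nrm_ge0 ?addr_ge0//.
rewrite nrm_sqr sqrrD !real_normK ?num_real//.
have : 0 <= `|complex.Re z| * `|complex.Im z| by rewrite mulr_ge0.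
lra.
Qed.
End Complex.

Section Inner.
Context {R : realType} {H : hilbertType R}.
Implicit Types (u v w : H) (a : R[i]).

Lemma innerC u v : '[< u, v >] = ('[< v, u >]^*)%C.
Proof. by rewrite (@hermC _ _ _ _ (@inner R H)) expr0 mul1r. Qed.

Lemma innerDl u v w : '[< u + v, w >] = '[< u, w >] + '[< v, w >].
Proof. exact: linearDl. Qed.
Lemma innerBl u v w : '[< u - v, w >] = '[< u, w >] - '[< v, w >].
Proof. exact: linearBl. Qed.
Lemma innerDr u v w : '[< w, u + v >] = '[< w, u >] + '[< w, v >].
Proof. exact: linearDr. Qed.
Lemma innerBr u v w : '[< w, u - v >] = '[< w, u >] - '[< w, v >].
Proof. exact: linearBr. Qed.
Lemma innerZl a u v : '[< a *: u, v >] = a * '[< u, v >].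
Proof. exact: linearZl_LR. Qed.
Lemma innerZr a u v : '[< u, a *: v >] = (a^*)%C * '[< u, v >].
Proof. exact: linearZr_LR. Qed.
Lemma inner0l u : '[< 0, u >] = 0.
Proof. exact: linear0l. Qed.
Lemma inner0r u : '[< u, 0 >] = 0.
Proof. exact: linear0r. Qed.

Lemma inner_nrm u : '[< u, u >] = (nrm u ^+ 2)%:C.
Proof. by rewrite innerxx nrmE rmorphXn. Qed.

End Inner.

(** * Geometry of Hilbert spaces *)

Lemma invS_small {R : realType} (e : R) : 0 < e ->
  exists N, forall n, (N <= n)%N -> n.+1%:R^-1 < e.
Proof.
move=> e0; have /cvgrPdist_lt/(_ e e0)[N _ NP] := @cvg_harmonic R.
exists N => n /NP /=; rewrite sub0r normrN ger0_norm ?invr_ge0//.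
Qed.

Section HilbertGeometry.
Context {R : realType} {H : hilbertType R}.
Implicit Types (u v w : H) (a : R[i]).

Lemma nrm_subZ u v a : nrm (u - a *: v) ^+ 2 =
  nrm u ^+ 2 - 2 * complex.Re ((a^*)%C * '[< u, v >]) + nrm a ^+ 2 * nrm v ^+ 2.
Proof.
have E w : nrm w ^+ 2 = complex.Re '[< w, w >] by rewrite inner_nrm.
rewrite E innerBl !innerBr !innerZl !innerZr !inner_nrm (innerC v u) nrm_sqr.
by case: '[< u, v >] => x y; case: a => p q /=; ring.
Qed.

(** With [a *: v] the orthogonal projection of [u] on the line of [v], this is
    Pythagoras; it gives the Cauchy-Schwarz inequality, and the orthogonality of
    best approximations. *)
Lemma inner_gap u v : exists a,
  nrm '[< u, v >] ^+ 2 = (nrm u ^+ 2 - nrm (u - a *: v) ^+ 2) * nrm v ^+ 2.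
Proof.
have [->|/eqP v0] := eqVneq v 0.
  by exists 0; rewrite inner0r !nrm0 !expr0n mulr0.
have {}v0 : nrm v != 0 by rewrite gt_eqF// nrm_gt0.
exists ((nrm v ^+ 2)^-1%:C * '[< u, v >]).
rewrite nrm_subZ nrmM nrm_real exprMn real_normK ?num_real//.
rewrite nrm_sqr; case: '[< u, v >] => x y /=.
by field.
Qed.

Lemma cauchy_schwarz u v : nrm '[< u, v >] <= nrm u * nrm v.
Proof.
rewrite -(ler_pXn2r (ltn0Sn 1)) ?nnegrE ?mulr_ge0 ?nrm_ge0//.
have [a ->] := inner_gap u v.
rewrite exprMn ler_wpM2r ?exprn_ge0 ?nrm_ge0// lerBlDr lerDl exprn_ge0//.
exact: nrm_ge0.
Qed.

Lemma parallelogram u v :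
  nrm (u + v) ^+ 2 + nrm (u - v) ^+ 2 = 2 * nrm u ^+ 2 + 2 * nrm v ^+ 2.
Proof.
have -> : u + v = u - (-1) *: v by rewrite scaleN1r opprK.
have -> : u - v = u - 1 *: v by rewrite scale1r.
rewrite !nrm_subZ !nrm_sqr; case: '[< u, v >] => x y /=; ring.
Qed.

Lemma hilbert_complete (f : nat -> H) :
  (forall e : R, 0 < e -> exists N, forall n m,
     (N <= n)%N -> (N <= m)%N -> nrm (f n - f m) < e) ->
  exists l : H, f n @[n --> \oo] --> l.
Proof.
move=> cf; suff : cvgn f by case/cvg_ex => l fl; exists l.
apply/cauchy_cvgP/cauchy_exP => -[e i]; rewrite ltcE /= => /andP[/eqP -> e0].
have [N fN] := cf e e0; exists (f N), N => // n /= Nn.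
rewrite -ball_normE /= nrmE complexr0 ltcR; exact: fN.
Qed.

Section Projection.
Variable V : set H.
Hypotheses (V0 : V 0) (Vlin : forall a u v, V u -> V v -> V (a *: u + v)).

(** A sequence of elements of [V] that minimizes the distance to [u] is Cauchy
    by the parallelogram law, and its limit is [p]. [V] need not be closed, so
    [p] is only a limit of elements of [V]. *)
Lemma projection u : exists p,
  (forall e : R, 0 < e -> exists2 v, V v & nrm (p - v) < e) /\
  (forall w, V w -> '[< u - p, w >] = 0).
Proof.
pose S := [set nrm (u - v) ^+ 2 | v in V].
have hS : has_inf S.
  split; first by exists (nrm (u - 0) ^+ 2), 0.
  by exists 0 => _ [v _ <-]; rewrite exprn_ge0// nrm_ge0.
pose D := inf S.
have DS v : V v -> D <= nrm (u - v) ^+ 2.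
  by move=> Vv; apply: ge_inf; [exact: hS.2|exists v].
have /choice[f fP] : forall k : nat, exists v,
    V v /\ nrm (u - v) ^+ 2 < D + k.+1%:R^-1.
  move=> k; have [|_ [v Vv <-] vD] := @inf_adherent _ S k.+1%:R^-1 _ hS.
    by rewrite invr_gt0.
  by exists v.
have Vf k := (fP k).1; have fD k := (fP k).2.
have fk k w : V w -> nrm '[< u - f k, w >] ^+ 2 <= k.+1%:R^-1 * nrm w ^+ 2.
  move=> Vw; have [a ->] := inner_gap (u - f k) w.
  rewrite ler_wpM2r ?exprn_ge0 ?nrm_ge0// lerBlDr (le_trans (ltW (fD k)))//.
  by rewrite addrC lerD2l -addrA -opprD; apply: DS; rewrite addrC; apply: (Vlin).
have fcau n m : nrm (f n - f m) ^+ 2 <= 2 * (n.+1%:R^-1 + m.+1%:R^-1).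
  have := parallelogram (u - f n) (u - f m).
  have -> : u - f n - (u - f m) = f m - f n by rewrite opprB addrC subrKA.
  have -> : u - f n + (u - f m) = 2 *: (u - (2^-1 *: f n + 2^-1 *: f m)).
    rewrite scalerBr scalerDr !scalerA mulfV ?pnatr_eq0// !scale1r.
    by rewrite scaler_nat mulr2n opprD addrACA.
  rewrite nrmZ nrm_nat exprMn (nrmB (f n)).
  have : D <= nrm (u - (2^-1 *: f n + 2^-1 *: f m)) ^+ 2.
    by apply/DS/Vlin => //; rewrite -[_ *: _]addr0; apply: (Vlin).
  have := fD n; have := fD m.
  move: (n.+1%:R^-1) (m.+1%:R^-1) (nrm (u - f m) ^+ 2) => a b c; lra.
have [|p fp] := @hilbert_complete f.
  move=> e e0; have [|N NP] := @invS_small R (e ^+ 2 / 4).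
    by rewrite divr_gt0// exprn_gt0.
  exists N => n m /NP Nn /NP Nm.
  rewrite -(ltr_pXn2r (ltn0Sn 1)) ?nnegrE ?nrm_ge0 ?(ltW e0)//.
  apply: le_lt_trans (fcau n m) _.
  by move: Nn Nm; move: (n.+1%:R^-1) (m.+1%:R^-1) => a b; lra.
move/nrm_seqP in fp; exists p; split => [e /fp[N /(_ N (leqnn N)) pN]|w Vw].
  by exists (f N).
apply: nrm_eq0; apply/eqP; rewrite eq_le nrm_ge0 andbT.
apply/ler_addgt0Pr => e e0; rewrite add0r.
have w1 : 0 < 1 + nrm w by rewrite ltr_pwDl// nrm_ge0.
pose d := e / 2 / (1 + nrm w).
have d0 : 0 < d by rewrite !divr_gt0.
have d1 : 0 <= d * (1 + nrm w) by rewrite ltW// mulr_gt0.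
have [N1 NP1] := fp d d0.
have [|N2 NP2] := @invS_small R (d ^+ 2); first by rewrite exprn_gt0.
pose N := maxn N1 N2.
have -> : u - p = (u - f N) - (p - f N) by rewrite opprB addrA subrK.
rewrite innerBl (le_trans (nrm_sub _ _))//.
have I1 : nrm '[< u - f N, w >] <= d * (1 + nrm w).
  rewrite -(ler_pXn2r (ltn0Sn 1)) ?nnegrE ?nrm_ge0//.
  rewrite exprMn (le_trans (fk N w Vw))// ler_pM ?exprn_ge0 ?nrm_ge0 ?invr_ge0//.
    by rewrite ltW// NP2// leq_maxr.
  by rewrite ler_pXn2r ?nnegrE ?nrm_ge0 ?(ltW w1)// lerDr.
have I2 : nrm '[< p - f N, w >] <= d * (1 + nrm w).
  rewrite (le_trans (cauchy_schwarz _ _))// ler_pM ?nrm_ge0// ?lerDr//.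
  by rewrite ltW// NP1// leq_maxl.
have dE : d * (1 + nrm w) = e / 2 by rewrite /d divfK// gt_eqF.
by move: I1 I2; rewrite dE; lra.
Qed.
End Projection.

(** Builds a sequence each of whose terms depends on all the previous ones. *)
Lemma exists_history (T : Type) (next : seq T -> T) :
  exists e : nat -> T, forall n, e n = next (mkseq e n).
Proof.
pose L := fix L n := if n is k.+1 then rcons (L k) (next (L k)) else [::].
exists (fun n => next (L n)) => n; congr next.
by elim: n => // n IH; rewrite mkseqS -IH.
Qed.

Definition orthonormal_upto (n : nat) (e : nat -> H) :=
  (forall i, (i < n)%N -> nrm (e i) = 1) /\
  (forall i j, (i < n)%N -> (j < n)%N -> i != j -> '[< e i, e j >] = 0).

Lemma inner_sum_orthonormal n e (a : nat -> R[i]) i : orthonormal_upto n e ->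
  (i < n)%N -> '[< \sum_(j < n) a j *: e j, e i >] = a i.
Proof.
move=> [e1 e0] ni.
rewrite (big_morph (fun x => '[< x, e i >]) (fun u v => innerDl u v _) (inner0l _)).
rewrite (bigD1 (Ordinal ni))//= innerZl inner_nrm e1// expr1n mulr1 big1 ?addr0//.
by move=> j ji; rewrite innerZl e0 ?mulr0.
Qed.

(** Pick unit vectors of [V] orthogonal to all the previous ones: either this
    never stops, or it stops at a finite orthonormal basis of [V]. *)
Lemma orthonormal_basis (V : set H) (V0 : V 0)
    (Vlin : forall a u v, V u -> V v -> V (a *: u + v)) :
  (exists n (e : nat -> H), [/\ orthonormal_upto n e, forall i, (i < n)%N -> V (e i)
     & forall v, V v -> v = \sum_(i < n) '[< v, e i >] *: e i]) \/
  (exists e : nat -> H, (forall n, orthonormal_upto n e) /\ forall n, V (e n)).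
Proof.
pose P (s : seq H) v :=
  [/\ V v, nrm v = 1 & forall i, (i < size s)%N -> '[< v, nth 0 s i >] = 0].
have [next nextP] : exists next : seq H -> H, forall s, (exists v, P s v) -> P s (next s).
  have /choice[nx nxP] : forall s, exists v, (exists v, P s v) -> P s v.
    move=> s; have [[v Pv]|nP] := pselect (exists v, P s v); last by exists 0.
    by exists v.
  by exists nx.
have [e eE] := exists_history _ next.
have eP n : (exists v, P (mkseq e n) v) -> P (mkseq e n) (e n).
  by rewrite eE; exact: nextP.
have eO n : (forall m, (m < n)%N -> P (mkseq e m) (e m)) -> orthonormal_upto n e.
  move=> Pe; split=> [i /Pe[]//|i j ni nj].
  rewrite neq_ltn => /orP[] ij; last first.
    have [_ _ /(_ j)] := Pe i ni; rewrite size_mkseq => /(_ ij).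
    by rewrite nth_mkseq.
  have [_ _ /(_ i)] := Pe j nj; rewrite size_mkseq => /(_ ij).
  by rewrite nth_mkseq// => E; rewrite innerC E conjc0.
have [allP|] := pselect (forall n, P (mkseq e n) (e n)).
  by right; exists e; split => n; [exact: eO|have [] := allP n].
move=> /existsNP nP; left.
have exn : exists n, `[< ~ P (mkseq e n) (e n) >].
  by case: nP => n Pn; exists n; apply/asboolP.
case: (ex_minnP exn) => n /asboolP Pn minn; exists n, e.
have Pm m : (m < n)%N -> P (mkseq e m) (e m).
  by move=> mn; apply: contrapT => /asboolP/minn; rewrite leqNgt mn.
have [e1 e0] := eO n Pm.
have Ve i : (i < n)%N -> V (e i) by move=> /Pm[].
split=> // v Vv; apply: contrapT => vE; apply/Pn/eP.
pose w := v - \sum_(i < n) '[< v, e i >] *: e i.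
have w0 : w <> 0 by move/subr0_eq.
have Vw : V w.
  rewrite /w addrC -scaleN1r; apply: (Vlin) => //.
  elim: {-2}n (leqnn n) => [|k IH] kn; first by rewrite big_ord0.
  by rewrite big_ord_recr /= addrC; apply: (Vlin); [exact: Ve|exact/IH/ltnW].
exists ((nrm w)^-1%:C *: w); split.
- by rewrite -[_ *: _]addr0; apply: (Vlin).
- rewrite nrmZ nrm_real ger0_norm ?invr_ge0 ?nrm_ge0// mulVf// gt_eqF//.
  exact: nrm_gt0.
- move=> i; rewrite size_mkseq => ni; rewrite nth_mkseq// innerZl.
  suff -> : '[< w, e i >] = 0 by rewrite mulr0.
  rewrite innerBl (inner_sum_orthonormal n e (fun i => '[< v, e i >]))//.
  exact: subrr.
Qed.

(** Subtracting from [v] its first [n] components leaves a vector [w n] with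
    [|w n.+1|^2 = |w n|^2 - |<v, e n>|^2]; the left-hand sides converge. *)
Lemma bessel_cvg0 (e : nat -> H) : (forall n, orthonormal_upto n e) ->
  weakly_cvg e 0.
Proof.
move=> eO v; rewrite inner0l.
pose w n := v - \sum_(i < n) '[< v, e i >] *: e i.
have wS n : nrm (w n.+1) ^+ 2 = nrm (w n) ^+ 2 - nrm '[< v, e n >] ^+ 2.
  have [e1 e0] := eO n.+1.
  have ew : '[< w n, e n >] = '[< v, e n >].
    rewrite innerBl.
    rewrite (big_morph (fun x => '[< x, e n >]) (fun u v => innerDl u v _) (inner0l _)).
    rewrite big1 ?subr0// => i _; rewrite innerZl e0 ?mulr0//.
      by rewrite ltnS ltnW.
    by rewrite neq_ltn ltn_ord.
  have -> : w n.+1 = w n - '[< v, e n >] *: e n.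
    by rewrite /w big_ord_recr /= opprD addrA.
  rewrite nrm_subZ ew e1// expr1n mulr1 !nrm_sqr.
  by case: '[< v, e n >] => x y /=; ring.
have /cvgrPdist_lt cw : cvgn (fun n => nrm (w n) ^+ 2 : R).
  apply: nonincreasing_is_cvgn.
    apply/nonincreasing_seqP => n.
    by rewrite wS lerBlDr lerDl exprn_ge0// nrm_ge0.
  by exists 0 => _ [n _ <-]; rewrite exprn_ge0// nrm_ge0.
apply/nrm_seqP => d d0.
have [|N _ NP] := cw (d ^+ 2 / 2); first by rewrite divr_gt0// exprn_gt0.
exists N => n Nn; rewrite sub0r nrmN innerC nrm_conj.
rewrite -(ltr_pXn2r (ltn0Sn 1)) ?nnegrE ?nrm_ge0 ?(ltW d0)//.
have /= := NP n Nn; have /= := NP n.+1 (leqW Nn).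
rewrite wS !ltr_norml => /andP[A1 A2] /andP[B1 B2].
move: A1 A2 B1 B2; set l := limn _; lra.
Qed.

End HilbertGeometry.

(** * Self-adjoint operators and resolvents *)

Lemma nrm_small0 {R : realType} {V : normedModType R[i]} (x : V) :
  (forall e : R, 0 < e -> nrm x <= e) -> x = 0.
Proof.
move=> xe; apply/nrm_eq0/eqP; rewrite eq_le nrm_ge0 andbT.
by apply/ler_addgt0Pr => e /xe; rewrite add0r.
Qed.

Section OperatorTheory.
Context {R : realType} {H : hilbertType R}.
Implicit Types (u v w x : H) (l : R[i]) (A : operator H).

Lemma op0 A : A 0 = 0.
Proof.
have := @op_linear _ _ A 1 0 0 (dom0 A) (dom0 A).
by rewrite scaler0 scale1r addr0 -[LHS]addr0 => /addrI.
Qed.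

Lemma domB A u v : dom A u -> dom A v -> dom A (u - v).
Proof. by move=> Au Av; rewrite addrC -scaleN1r; apply: dom_linear. Qed.

Lemma domZ A a u : dom A u -> dom A (a *: u).
Proof. by move=> Au; rewrite -[_ *: _]addr0; apply: dom_linear => //; exact: dom0. Qed.

Lemma opB A u v : dom A u -> dom A v -> A (u - v) = A u - A v.
Proof.
by move=> Au Av; rewrite addrC -scaleN1r op_linear// scaleN1r addrC.
Qed.

Lemma opZ A a u : dom A u -> A (a *: u) = a *: A u.
Proof.
by move=> Au; rewrite -[_ *: _]addr0 op_linear ?op0 ?addr0//; exact: dom0.
Qed.

Lemma shift_linear A l a u v : dom A u -> dom A v ->
  A (a *: u + v) - l *: (a *: u + v) = a *: (A u - l *: u) + (A v - l *: v).
Proof.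
move=> Au Av; rewrite op_linear// scalerBr scalerDr !scalerA opprD addrACA.
by rewrite (mulrC l).
Qed.

Lemma shiftB A l u v : dom A u -> dom A v ->
  A (u - v) - l *: (u - v) = (A u - l *: u) - (A v - l *: v).
Proof.
move=> Au Av; rewrite opB// scalerBr !opprB (addrC (l *: v)) addrACA.
by rewrite (addrC (- A v)).
Qed.

Section SelfAdjoint.
Variable T0 : operator H.
Hypothesis T0_sa : self_adjoint T0.

Lemma sa_sym u v : dom T0 u -> dom T0 v -> '[< T0 u, v >] = '[< u, T0 v >].
Proof.
case: T0_sa => _ gE uT vT.
have : adjoint_graph T0 (v, T0 v) by rewrite gE.
exact.
Qed.

(** The domain of a self-adjoint operator contains that of its adjoint. *)
Lemma sa_max v w : (forall u, dom T0 u -> '[< T0 u, v >] = '[< u, w >]) ->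
  dom T0 v /\ T0 v = w.
Proof.
case: T0_sa => _ gE vw; have : adjoint_graph T0 (v, w) by [].
by rewrite gE => -[/= ? ->].
Qed.

Lemma sa_Im0 u : dom T0 u -> complex.Im '[< T0 u, u >] = 0.
Proof.
move=> uT; have := sa_sym _ _ uT uT; rewrite [X in _ = X]innerC.
case: '[< _, _ >] => x y [] /eqP; rewrite -addr_eq0 -mulr2n.
by rewrite mulrn_eq0 /= => /eqP.
Qed.

Lemma sa_closed (f : nat -> H) x w : (forall n, dom T0 (f n)) ->
  f n @[n --> \oo] --> x -> T0 (f n) @[n --> \oo] --> w ->
  dom T0 x /\ T0 x = w.
Proof.
move=> fT /nrm_seqP fx /nrm_seqP fw; apply: sa_max => u uT.
apply/subr0_eq/nrm_small0 => e e0.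
pose M := 1 + nrm (T0 u) + nrm u.
have u0 := nrm_ge0 u; have Tu0 := nrm_ge0 (T0 u).
have M0 : 0 < M by rewrite /M; lra.
have [N1 /(_ (maxn N1 _)) P1] := fx (e / M) (divr_gt0 e0 M0).
have [N2 /(_ (maxn _ N2)) P2] := fw (e / M) (divr_gt0 e0 M0).
have {}P1 := ltW (P1 N2 (leq_maxl _ _)); have {}P2 := ltW (P2 N1 (leq_maxr _ _)).
move: P1 P2; set n := maxn N1 N2 => P1 P2.
have -> : '[< T0 u, x >] - '[< u, w >] =
    '[< T0 u, x - f n >] - '[< u, w - T0 (f n) >].
  by rewrite !innerBr (sa_sym u (f n))// opprB addrA subrK.
rewrite (le_trans (nrm_sub _ _))//.
have := ler_wpM2l Tu0 P1; have := ler_wpM2l u0 P2.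
have := cauchy_schwarz (T0 u) (x - f n).
have := cauchy_schwarz u (w - T0 (f n)).
have : e = (1 + nrm (T0 u) + nrm u) * (e / M) by rewrite mulrC divfK// gt_eqF.
have : 0 <= e / M by rewrite divr_ge0// ltW.
lra.
Qed.

End SelfAdjoint.

(** The lower bound makes the inverse single-valued, hence linear, and bounded
    by [1 / k]. *)
Lemma resolvent_of_inverse A l (k : R) : 0 < k ->
  (forall u, dom A u -> k * nrm u <= nrm (A u - l *: u)) ->
  (forall v, exists u, dom A u /\ A u - l *: u = v) -> resolvent_set A l.
Proof.
move=> k0 Ak /choice[B BP].
have BD v : dom A (B v) by have [] := BP v.
have BE v : A (B v) - l *: B v = v by have [] := BP v.
have inj u v : dom A u -> dom A v -> A u - l *: u = A v - l *: v -> u = v.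
  move=> uA vA E; apply/subr0_eq/nrm_eq0/eqP; rewrite eq_le nrm_ge0 andbT.
  rewrite -(ler_pM2l k0) mulr0 (le_trans (Ak _ (domB _ _ _ uA vA)))//.
  by rewrite shiftB// E subrr nrm0.
have Blin : linear B.
  move=> a v w; apply: inj => //; first exact: dom_linear.
  by rewrite shift_linear// !BE.
pose Bl := GRing.isLinear.Build _ _ _ _ B Blin.
pose B' : {linear H -> H} := HB.pack B Bl.
exists B'; split=> [v|v//|u uA]; last exact: inj.
apply/nrm_cvgP => e e0.
have /nrm_cvgP/(_ (e * k)) : id @ nbhs v --> v by exact: cvg_id.
rewrite mulr_gt0// => /(_ isT); apply: filterS => t vt.
rewrite -(ltr_pM2l k0) mulrC (le_lt_trans _ (y := nrm (v - t)))// ?(mulrC k e)//.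
by rewrite mulrC (le_trans (Ak _ (domB _ _ _ (BD _) (BD _))))// shiftB// !BE.
Qed.

Lemma resolvent_bounded A l : resolvent_set A l -> exists (B : {linear H -> H}) (M : R),
  [/\ 0 < M, forall v, nrm (B v) <= M * nrm v,
      forall v, dom A (B v) /\ A (B v) - l *: B v = v &
      forall u, dom A u -> B (A u - l *: u) = u].
Proof.
move=> [B [Bc BA AB]].
have B0 : B 0 = 0 by exact: linear0.
have /nrm_cvgP/(_ 1 ltr01) /nbhs_normP [[d i]] := Bc 0.
rewrite /= ltcE /= => /andP[/eqP -> d0] dB; exists B, (2 / d); split => //.
  by rewrite divr_gt0.
move=> v; have [->|/eqP/nrm_gt0 v0] := eqVneq v 0; first by rewrite B0 !nrm0 mulr0.
pose c := d / 2 / nrm v.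
have c0 : 0 < c by rewrite !divr_gt0.
have := dB (c%:C *: v).
rewrite /ball_ /= sub0r normrN nrmE complexr0 ltcR nrmZ nrm_real gtr0_norm//.
rewrite /c divfK ?gt_eqF// B0 sub0r nrmN linearZ nrmZ nrm_real gtr0_norm//.
have -> : d / 2 < d by rewrite ltr_pdivrMr// ltr_pMr// ltrDl.
move=> /(_ isT) /ltW cB.
have -> : 2 / d * nrm v = c^-1 by rewrite /c !invfM !invrK; field; rewrite !gt_eqF.
by rewrite -[leRHS]mulr1 ler_pdivlMl.
Qed.

(** The lower bound for [T0 + S - l], together with the closedness of [T0],
    makes its range closed. A vector orthogonal to the range lies in the domain
    of [T0] and in the kernel of the adjoint [T0 + S' - l^*], which is trivial
    by the second bound. *)
Lemma perturbed_resolvent (T0 : operator H) (S S' : {linear H -> H}) (C k : R) l :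
  self_adjoint T0 -> (forall u, nrm (S u) <= C * nrm u) ->
  (forall u v, '[< S u, v >] = '[< u, S' v >]) -> 0 < k ->
  (forall u, dom T0 u -> k * nrm u <= nrm ((T0 u + S u) - l *: u)) ->
  (forall u, dom T0 u -> k * nrm u <= nrm (T0 u + S' u - (l^*)%C *: u)) ->
  resolvent_set (op_add T0 S) l.
Proof.
move=> T0_sa SC SS' k0 kl kl'; apply: (resolvent_of_inverse _ _ _ k0) => // u.
pose A := op_add T0 S.
pose V := [set A x - l *: x | x in dom T0].
have V0 : V 0 by exists 0; [exact: dom0|rewrite op0 scaler0 subr0].
have Vlin a v w : V v -> V w -> V (a *: v + w).
  move=> [x xT <-] [y yT <-]; exists (a *: x + y); first exact: dom_linear.
  exact: (shift_linear A).
have [p [pV pO]] := projection V V0 Vlin u.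
have up : u = p.
  apply/subr0_eq; move: (u - p) pO => w wO.
  have [wT wE] : dom T0 w /\ T0 w = (l^*)%C *: w - S' w.
    apply: sa_max => // x xT; apply/subr0_eq.
    rewrite innerBr innerZr conjcK -SS' -innerZl opprB addrA -innerDl -innerBl.
    by rewrite innerC wO ?conjc0//; exists x.
  apply/nrm_eq0/eqP; rewrite eq_le nrm_ge0 andbT -(ler_pM2l k0) mulr0.
  by rewrite (le_trans (kl' _ wT))// wE subrK subrr nrm0.
have /choice[x xP] : forall n : nat, exists x,
    dom T0 x /\ nrm (u - (A x - l *: x)) < n.+1%:R^-1.
  move=> n; have [|_ [x xT <-] xp] := pV n.+1%:R^-1; first by rewrite invr_gt0.
  by exists x; rewrite up.
have xT n := (xP n).1; have xE n := (xP n).2.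
have [e e0|y xy] := @hilbert_complete _ _ x.
  have [|N NP] := @invS_small R (e * k / 2); first by rewrite divr_gt0// mulr_gt0.
  exists N => n m /NP Nn /NP Nm; rewrite -(ltr_pM2l k0).
  apply: le_lt_trans (kl _ (domB _ _ _ (xT n) (xT m))) _.
  have := shiftB A l _ _ (xT n : dom A (x n)) (xT m : dom A (x m)); rewrite /= => ->.
  have := nrm_tri u (A (x n) - l *: x n) (A (x m) - l *: x m).
  rewrite (nrmB _ u) /=; have := xE n; have := xE m; move: Nn Nm => /=.
  move: (n.+1%:R^-1) (m.+1%:R^-1) => a b; lra.
have Ax : A (x n) - l *: x n @[n --> \oo] --> u.
  apply/nrm_seqP => e /invS_small[N NP]; exists N => n /NP.
  by apply: lt_trans; exact: xE.
have Sx : S (x n) @[n --> \oo] --> S y.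
  apply/nrm_seqP => e e0; have C0 : 0 < 1 + `|C| by rewrite ltr_pwDl.
  have [N NP] := (nrm_seqP _ _).1 xy (e / (1 + `|C|)) (divr_gt0 e0 C0).
  exists N => n /NP xn; rewrite -linearB (le_lt_trans (SC _))//.
  have := nrm_ge0 (y - x n); have := ler_norm C.
  have : e = (1 + `|C|) * (e / (1 + `|C|)) by rewrite mulrC divfK// gt_eqF.
  nra.
have [|yT yE] := sa_closed T0 T0_sa x y (u - S y + l *: y) xT xy.
  have -> : (fun n => T0 (x n)) = fun n => A (x n) - l *: x n - S (x n) + l *: x n.
    by apply/funext => n; rewrite [RHS]addrAC subrK /= addrK.
  by apply: cvgD; [apply: cvgB|apply: cvgZr].
by exists y; split => //=; rewrite yE addrAC addrK subrK.
Qed.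

End OperatorTheory.

(** * A maximum principle for resolvents *)

Section MaximumPrinciple.
Context {R : realType} {H : hilbertType R}.
Variables (A : operator H) (psi : H).
Implicit Types (u : H) (l z : R[i]).

(** When [l] is in the resolvent set, the only solution is the value at [l] of
    the resolvent applied to [psi]. *)
Definition solves l u := dom A u /\ A u - l *: u = psi.

Section MeanValue.
Variables (l : R[i]) (B : {linear H -> H}) (u0 : H).
Hypothesis BK : forall u, dom A u -> B (A u - l *: u) = u.
Hypothesis s0 : solves l u0.

Let BD u v : B (u + v) = B u + B v. Proof. exact: linearD. Qed.
Let BN u : B (- u) = - B u. Proof. exact: linearN. Qed.
Let BZ a u : B (a *: u) = a *: B u. Proof. exact: linearZ. Qed.

(** The resolvent identity. *)
Lemma solves_step z u : solves (l + z) u -> u = u0 + z *: B u.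
Proof.
case: s0 => [u0A u0E] [uA uE]; apply/eqP; rewrite addrC -subr_eq -linearZ; apply/eqP.
rewrite -(BK _ (domB _ _ _ uA u0A)) shiftB// u0E -uE; congr (B _).
by rewrite scalerDl opprB addrC addrA subrK (addrC (l *: u)) addrK.
Qed.

Lemma solves_pair z u v : solves (l + z) u -> solves (l - z) v ->
  u + v = u0 + u0 + z ^+ 2 *: B (B (u + v)).
Proof.
move=> /solves_step uE /solves_step vE.
have uE2 : u = u0 + z *: B u0 + z ^+ 2 *: B (B u).
  by rewrite {1}uE {1}uE BD BZ scalerDr scalerA addrA.
have vE2 : v = u0 - z *: B u0 + z ^+ 2 *: B (B v).
  by rewrite {1}vE {1}vE BD BZ scalerDr scalerA addrA mulrNN scaleNr.
rewrite {1}uE2 {1}vE2 !BD scalerDr addrACA; congr (_ + _).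
by rewrite addrACA subrr addr0.
Qed.

(** The discrete mean value property: when [w = i z], the four points
    [l + i^j z] make the terms of degree 1, 2 and 3 of the Neumann series of
    the resolvent at [l] cancel out, which leaves an error of order [z^4]. *)
Lemma solves_mean z w u1 u2 u3 u4 : w ^+ 2 = - z ^+ 2 ->
  solves (l + z) u1 -> solves (l - z) u2 ->
  solves (l + w) u3 -> solves (l - w) u4 ->
  u1 + u2 + (u3 + u4) =
    4%:R *: u0 + z ^+ 4 *: B (B (B (B (u1 + u2 + (u3 + u4))))).
Proof.
move=> wz s1 s2 s3 s4.
have := solves_pair _ _ _ s1 s2; have := solves_pair _ _ _ s3 s4.
move: (u1 + u2) (u3 + u4) => p q; rewrite wz scaleNr => qE pE.
have pE2 : p = u0 + u0 + z ^+ 2 *: B (B (u0 + u0)) + z ^+ 4 *: B (B (B (B p))).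
  rewrite {1}pE {1}pE ![in LHS](BD, BN, BZ).
  by rewrite !BD !scalerDr scalerA -exprD !addrA.
have qE2 : q = u0 + u0 - z ^+ 2 *: B (B (u0 + u0)) + z ^+ 4 *: B (B (B (B q))).
  rewrite {1}qE {1}qE ![in LHS](BD, BN, BZ).
  by rewrite !BD !scalerDr scalerN scalerA -exprD !opprD opprK !addrA.
rewrite {1}pE2 {1}qE2 addrACA !BD scalerDr; congr (_ + _); rewrite ?scalerDr//.
by rewrite addrACA subrr addr0 -!mulr2n -mulrnA scaler_nat.
Qed.

Lemma solves_mean_le (M : R) z w u1 u2 u3 u4 : 0 <= M ->
  (forall v, nrm (B v) <= M * nrm v) -> w ^+ 2 = - z ^+ 2 ->
  solves (l + z) u1 -> solves (l - z) u2 ->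
  solves (l + w) u3 -> solves (l - w) u4 ->
  4 * nrm u0 <=
    (1 + nrm z ^+ 4 * M ^+ 4) * (nrm u1 + nrm u2 + (nrm u3 + nrm u4)).
Proof.
move=> M0 BM wz s1 s2 s3 s4.
have := solves_mean _ _ _ _ _ _ wz s1 s2 s3 s4.
have := nrmD (u1 + u2) (u3 + u4); have := nrmD u1 u2; have := nrmD u3 u4.
move: (u1 + u2) (u3 + u4) => p q; move: (p + q) => s qn pn sn /eqP.
rewrite -subr_eq => /eqP/(congr1 nrm).
rewrite nrmZ nrm_nat => <-; apply: le_trans (nrm_sub _ _) _.
have M4 : nrm (B (B (B (B s)))) <= M ^+ 4 * nrm s.
  rewrite !exprS expr0 mulr1 -!mulrA.
  by do 3!(apply: le_trans (BM _) _; rewrite ler_wpM2l//).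
rewrite nrmZ nrmX mulrDl mul1r lerD//; first by lra.
rewrite -mulrA ler_wpM2l ?exprn_ge0 ?nrm_ge0// (le_trans M4)//.
by rewrite ler_wpM2l ?exprn_ge0//; lra.
Qed.

End MeanValue.

(** The norm of the resolvent applied to [psi] is bounded on the square by its
    supremum on the boundary. Adding [eta * |l - l0|^2] with a small [eta > 0]
    makes it strictly subharmonic: around an interior point, the average over
    four points at distance [rho] exceeds the value at the centre by at least
    [eta * rho^2 - O(rho^4)], so that the maximum is on the boundary. *)
Lemma resolvent_max_principle l0 (r m : R) phi : 0 < r ->
  solves l0 phi ->
  (forall x y : R, `|x| <= r -> `|y| <= r -> resolvent_set A (l0 + Complex x y)) ->
  (forall (x y : R) u, `|x| <= r -> `|y| <= r -> `|x| = r \/ `|y| = r ->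
     solves (l0 + Complex x y) u -> nrm u <= m) ->
  nrm phi <= m.
Proof.
move=> r0 sphi res bdry.
pose K := `[- r, r]%classic `*` `[- r, r]%classic : set (R * R).
have KE p : K p <-> `|p.1| <= r /\ `|p.2| <= r.
  by rewrite /K /= !in_itv /= -!ler_norml; split=> -[].
pose L (p : R * R) := l0 + Complex p.1 p.2.
have /choice[g gP] : forall p, exists u, K p -> solves (L p) u.
  move=> p; have [/KE[p1 p2]|nK] := pselect (K p); last by exists 0.
  have [B [M [_ _ BA _]]] := resolvent_bounded _ _ (res _ _ p1 p2).
  by exists (B psi) => _; exact: BA.
(* By the resolvent identity [g p - g p0 = z *: B (g p)] with [z = L p - L p0];
   [d] makes [nrm z * M] at most 1/2, so that [nrm (g p)] is at most
   [2 * nrm (g p0)]. *)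
have gc : {within K, continuous (fun p => nrm (g p))}.
  apply/subspace_continuousP => p0 Kp0; apply/cvgrPdist_lt => e e0.
  have [p1 p2] := (KE _).1 Kp0.
  have [B [M [M0 BM _ BK]]] := resolvent_bounded _ _ (res _ _ p1 p2).
  pose N0 := nrm (g p0); have N00 : 0 <= N0 := nrm_ge0 _.
  pose d := Num.min (4 * M)^-1 (e / (4 * M * (1 + N0))).
  have d0 : 0 < d.
    by rewrite lt_min invr_gt0 !divr_gt0 ?mulr_gt0 ?ltr_pwDl.
  rewrite near_withinE; apply/nbhs_ballP; exists d => //= p [b1 b2] Kp.
  rewrite /ball /= in b1 b2.
  have Lp : L p = L p0 + Complex (p.1 - p0.1) (p.2 - p0.2).
    by rewrite /L -addrA; congr (_ + _); apply/eqP; rewrite eq_complex /=; lra.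
  have := solves_step _ _ _ BK (gP _ Kp0) (Complex (p.1 - p0.1) (p.2 - p0.2)) (g p).
  rewrite -Lp => /(_ (gP _ Kp)) E.
  pose z := Complex (p.1 - p0.1) (p.2 - p0.2).
  have zd : nrm z <= 2 * d.
    rewrite (le_trans (nrm_le_ReIm _))//= (distrC p.1) (distrC p.2); lra.
  have D1 : nrm (g p - g p0) <= 2 * d * M * nrm (g p).
    rewrite {1}E addrC addKr nrmZ -mulrA ler_pM ?nrm_ge0//.
  have N0E : (1 + N0) != 0 by rewrite gt_eqF// ltr_pwDl.
  have dM1 : 2 * d * M <= 1 / 2.
    have : d * (4 * M) <= 1.
      by rewrite -ler_pdivlMr ?mulr_gt0// div1r ge_min lexx.
    lra.
  have dM2 : 4 * d * M * (1 + N0) <= e.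
    have : d <= e / (4 * M * (1 + N0)) by rewrite ge_min lexx orbT.
    by rewrite ler_pdivlMr ?mulr_gt0 ?ltr_pwDl//; lra.
  have D2 : nrm (g p) <= 2 * N0.
    have := nrm_tri (g p0) (g p) 0; rewrite !subr0 -/N0 => D2.
    have := ler_wpM2r (nrm_ge0 (g p)) dM1; lra.
  have D3 : `|N0 - nrm (g p)| <= nrm (g p - g p0).
    rewrite ler_norml; have := nrm_tri (g p0) (g p) 0; have := nrm_tri (g p) (g p0) 0.
    by rewrite !subr0 (nrmB (g p0)) -/N0; lra.
  apply: le_lt_trans D3 _; apply: le_lt_trans D1 _.
  have dM0 : 0 < d * M by rewrite mulr_gt0.
  have := ler_wpM2l (ltW dM0) D2; lra.
have Kc : compact K by apply: compact_setX; exact: segment_compact.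
have K0 : K (0, 0) by rewrite KE /= normr0 ltW.
have Kne : K !=set0 by exists (0, 0).
have gphi : g (0, 0) = phi.
  have [p1 p2] := (KE _).1 K0.
  have [B [M [M0 BM _ BK]]] := resolvent_bounded _ _ (res _ _ p1 p2).
  have [+ +] := gP _ K0; rewrite /L /= => g1 g2.
  have [] := sphi; have <- : l0 + Complex 0 0 = l0 by rewrite addr0.
  by move=> p3 p4; rewrite -(BK _ g1) g2 -p4 BK.
rewrite -gphi; apply/ler_addgt0Pr => e e0.
(* [eta] is such that the added term is at most [e] on the square. *)
pose eta := e / (2 * r ^+ 2).
have eta0 : 0 < eta by rewrite divr_gt0 ?mulr_gt0 ?exprn_gt0.
pose h p := nrm (g p) + eta * (p.1 ^+ 2 + p.2 ^+ 2).
have hc : {within K, continuous h}.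
  have qc : continuous (fun p : R * R => eta * (p.1 ^+ 2 + p.2 ^+ 2)).
    move=> p; apply: cvgM; first exact: cvg_cst.
    by apply: cvgD; apply: cvgM; (apply: cvg_fst || apply: cvg_snd).
  move=> p; apply: cvgD; first exact: gc.
  exact: (continuous_subspaceT qc).
have [p0 /set_mem Kp0 hmax] := compact_EVT_max Kne Kc hc.
have {}hmax p : K p -> h p <= h p0 by move=> Kp; apply: hmax; exact: mem_set.
have [p1 p2] := (KE _).1 Kp0.
have sq_le x : `|x| <= r -> x ^+ 2 <= r ^+ 2.
  by move=> xr; rewrite -real_normK ?num_real// ler_pXn2r ?nnegrE// ltW.
have [bd|int] := pselect (`|p0.1| = r \/ `|p0.2| = r).
  have h00 : nrm (g (0, 0)) <= h p0.
    by have := hmax _ K0; rewrite {1}/h /= expr0n addr0 mulr0 addr0.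
  apply: le_trans h00 _; rewrite /h lerD//.
    exact: bdry p1 p2 bd (gP _ Kp0).
  have -> : e = eta * (r ^+ 2 + r ^+ 2).
    by rewrite /eta; field; rewrite gt_eqF.
  by rewrite ler_wpM2l ?(ltW eta0)// lerD// sq_le.
exfalso.
have {}p1 : `|p0.1| < r by rewrite lt_neqAle p1 andbT; apply/eqP => E; apply: int; left.
have {}p2 : `|p0.2| < r by rewrite lt_neqAle p2 andbT; apply/eqP => E; apply: int; right.
have [B [M [M0 BM _ BK]]] := resolvent_bounded _ _ (res _ _ (ltW p1) (ltW p2)).
pose N0 := nrm (g p0); have N00 : 0 <= N0 := nrm_ge0 _.
have M40 : 0 < M ^+ 4 * (1 + N0) by rewrite mulr_gt0 ?exprn_gt0 ?ltr_pwDl.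
pose rho := Num.min (Num.min 1 (eta / (M ^+ 4 * (1 + N0))))
  (Num.min (r - `|p0.1|) (r - `|p0.2|)).
have rho0 : 0 < rho by rewrite !lt_min ltr01 divr_gt0//= !subr_gt0 p1.
have rho1 : rho <= 1 by rewrite !ge_min lexx.
have rhoeta : rho * (M ^+ 4 * (1 + N0)) <= eta.
  by rewrite -ler_pdivlMr// !ge_min lexx ?orbT.
have rhop1 : rho <= r - `|p0.1| by rewrite !ge_min lexx ?orbT.
have rhop2 : rho <= r - `|p0.2| by rewrite !ge_min lexx ?orbT.
have K1 : K (p0.1 + rho, p0.2).
  rewrite KE /= (ltW p2); split=> //; have := ler_normD p0.1 rho.
  by rewrite (gtr0_norm rho0); lra.
have K2 : K (p0.1 - rho, p0.2).
  rewrite KE /= (ltW p2); split=> //; have := ler_normB p0.1 rho.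
  by rewrite (gtr0_norm rho0); lra.
have K3 : K (p0.1, p0.2 + rho).
  rewrite KE /= (ltW p1); split=> //; have := ler_normD p0.2 rho.
  by rewrite (gtr0_norm rho0); lra.
have K4 : K (p0.1, p0.2 - rho).
  rewrite KE /= (ltW p1); split=> //; have := ler_normB p0.2 rho.
  by rewrite (gtr0_norm rho0); lra.
have LE x y : L (p0.1 + x, p0.2 + y) = L p0 + Complex x y by rewrite /L -addrA.
have := solves_mean_le _ _ _ BK (gP _ Kp0) M
  (Complex rho 0) (Complex 0 rho) _ _ _ _ (ltW M0) BM.
have -> : Complex 0 rho ^+ 2 = - Complex rho 0 ^+ 2.
  by apply/eqP; rewrite eq_complex /= !mulr0 !mul0r !subr0 !add0r oppr0 !eqxx.
move=> /(_ _ _ _ _ erefl).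
have -> : L p0 + Complex rho 0 = L (p0.1 + rho, p0.2) by rewrite -LE addr0.
have -> : L p0 - Complex rho 0 = L (p0.1 - rho, p0.2).
  by have := LE (- rho) 0; rewrite addr0 => ->; congr (_ + _);
     apply/eqP; rewrite eq_complex /= ?oppr0 !eqxx.
have -> : L p0 + Complex 0 rho = L (p0.1, p0.2 + rho) by rewrite -LE addr0.
have -> : L p0 - Complex 0 rho = L (p0.1, p0.2 - rho).
  by have := LE 0 (- rho); rewrite addr0 => ->; congr (_ + _);
     apply/eqP; rewrite eq_complex /= ?oppr0 !eqxx.
move=> /(_ _ _ _ _ (gP _ K1) (gP _ K2) (gP _ K3) (gP _ K4)).
have -> : nrm (Complex rho 0) = rho by rewrite (nrm_real rho) gtr0_norm.
have := hmax _ K1; have := hmax _ K2; have := hmax _ K3; have := hmax _ K4.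
rewrite /h /= -/N0.
set S := _ + _ + (_ + _) => h4 h3 h2 h1 mean.
have SN : S + 4 * (eta * rho ^+ 2) <= 4 * N0 by rewrite /S; lra.
have P0 : 0 <= rho ^+ 4 * M ^+ 4 by rewrite mulr_ge0// exprn_ge0// ltW.
have etarho : 0 <= eta * rho ^+ 2 by rewrite mulr_ge0 ?exprn_ge0// ltW.
have SN0 : S <= 4 * N0 by lra.
have := ler_wpM2l P0 SN0 => PS.
have : eta * rho ^+ 2 <= rho ^+ 2 * (M ^+ 4 * N0) * rho ^+ 2 by lra.
rewrite ler_pM2r ?exprn_gt0// => eta_le.
have M4 : 0 < M ^+ 4 by rewrite exprn_gt0.
have : rho ^+ 2 * (M ^+ 4 * N0) <= rho * (M ^+ 4 * N0).
  apply: ler_wpM2r; first by rewrite mulr_ge0// ltW.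
  by rewrite expr2 ler_piMl// ltW.
have : 0 < rho * M ^+ 4 by rewrite mulr_gt0.
lra.
Qed.

End MaximumPrinciple.

(** * Isolated eigenvalues of a self-adjoint operator *)

Section Eigenspace.
Context {R : realType} {H : hilbertType R}.
Variables (T0 : operator H) (mu : R).
Hypothesis T0_sa : self_adjoint T0.
Implicit Types (u v w x : H).

Definition eigenspace : set H := [set v | dom T0 v /\ T0 v = mu%:C *: v].

Lemma eigenspace0 : eigenspace 0.
Proof. by split; [exact: dom0|rewrite op0 scaler0]. Qed.

Lemma eigenspace_linear a u v :
  eigenspace u -> eigenspace v -> eigenspace (a *: u + v).
Proof.
move=> [uT uE] [vT vE]; split; first exact: dom_linear.
by rewrite op_linear// uE vE scalerDr !scalerA mulrC.
Qed.

Lemma shift_sym u x : dom T0 u -> dom T0 x ->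
  '[< T0 u - mu%:C *: u, x >] = '[< u, T0 x - mu%:C *: x >].
Proof.
by move=> uT xT; rewrite innerBl innerBr innerZl innerZr conjc_real sa_sym.
Qed.

Hypothesis mu_ess : ~ essential_spectrum T0 mu%:C.

(** Otherwise there are unit vectors [f n], orthogonal to the eigenspace, with
    [(T0 - mu) (f n)] tending to 0. They tend weakly to 0: on the range of
    [T0 - mu] by symmetry, hence on its closure, and the orthogonal complement
    of the range is the eigenspace. So [mu] would be in the essential
    spectrum. *)
Lemma eigenspace_gap : exists2 d : R, 0 < d &
  forall u, dom T0 u -> (forall v, eigenspace v -> '[< u, v >] = 0) ->
  d * nrm u <= nrm (T0 u - mu%:C *: u).
Proof.
apply: contrapT => nd; apply: mu_ess.
have /choice[f fP] : forall n : nat, exists u, [/\ dom T0 u, nrm u = 1,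
    forall v, eigenspace v -> '[< u, v >] = 0 &
    nrm (T0 u - mu%:C *: u) < n.+1%:R^-1].
  move=> n; apply: contrapT => nu; apply: nd; exists n.+1%:R^-1; rewrite ?invr_gt0//.
  move=> u uT uN; have [->|/eqP u0] := eqVneq u 0.
    by rewrite nrm0 mulr0 nrm_ge0.
  have {}u0 := nrm_gt0 _ u0.
  rewrite leNgt; apply/negP => small; apply: nu; exists ((nrm u)^-1%:C *: u); split.
  - exact: domZ.
  - by rewrite nrmZ nrm_real gtr0_norm ?invr_gt0// mulVf// gt_eqF.
  - by move=> v /uN uv; rewrite innerZl uv mulr0.
  - rewrite opZ// scalerA mulrC -scalerA -scalerBr nrmZ nrm_real gtr0_norm ?invr_gt0//.
    by rewrite mulrC ltr_pdivrMr.
have fT n : dom T0 (f n) by have [] := fP n.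
have f1 n : nrm (f n) = 1 by have [] := fP n.
have fN n v : eigenspace v -> '[< f n, v >] = 0 by have [_ _ + _] := fP n; apply.
have fS n : nrm (T0 (f n) - mu%:C *: f n) < n.+1%:R^-1 by have [] := fP n.
exists f; split=> [//|n|v|]; [by rewrite nrmE f1| |]; last first.
  apply/(@nrm_seqP R R[i]) => e /invS_small[N NP]; exists N => n /NP; apply: le_lt_trans.
  by rewrite sub0r nrmN nrmE nrm_real ger0_norm ?nrm_ge0// ltW.
rewrite inner0l; apply/(@nrm_seqP R R[i]) => e e0.
pose V := [set T0 x - mu%:C *: x | x in dom T0].
have V0 : V 0 by exists 0; [exact: dom0|rewrite op0 scaler0 subr0].
have Vlin a u w : V u -> V w -> V (a *: u + w).
  move=> [x xT <-] [y yT <-]; exists (a *: x + y); first exact: dom_linear.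
  exact: shift_linear.
have [p [pV pO]] := projection V V0 Vlin v.
have Nq : eigenspace (v - p).
  apply: (sa_max _ T0_sa) => x xT; apply/subr0_eq.
  rewrite innerZr conjc_real -innerZl -innerBl innerC pO ?conjc0//.
  by exists x.
have [|_ [x xT <-] px] := pV (e / 2); first by rewrite divr_gt0.
have M0 : 0 < 2 * (1 + nrm x) by rewrite mulr_gt0 ?ltr_pwDl ?nrm_ge0.
have [N NP] := invS_small _ (divr_gt0 e0 M0).
exists N => n /NP Nn; rewrite sub0r nrmN.
have -> : '[< f n, v >] = '[< f n, p - (T0 x - mu%:C *: x) >]
    + '[< T0 (f n) - mu%:C *: f n, x >].
  rewrite shift_sym// -innerDr subrK -[X in '[< _, X >] = _](subrK p) innerDr.
  by rewrite fN// add0r.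
apply: le_lt_trans (nrmD _ _) _.
have := cauchy_schwarz (f n) (p - (T0 x - mu%:C *: x)).
have := cauchy_schwarz (T0 (f n) - mu%:C *: f n) x.
have : nrm (T0 (f n) - mu%:C *: f n) * nrm x <= e / (2 * (1 + nrm x)) * nrm x.
  by rewrite ler_wpM2r ?nrm_ge0// ltW// (lt_trans (fS n)).
have : e / 2 = e / (2 * (1 + nrm x)) * (1 + nrm x).
  by field; rewrite gt_eqF ?ltr_pwDl ?nrm_ge0.
have : 0 < e / (2 * (1 + nrm x)) by rewrite divr_gt0.
rewrite f1; lra.
Qed.

(** An infinite orthonormal sequence of eigenvectors tends weakly to 0, so it
    would put [mu] in the essential spectrum. *)
Lemma eigenspace_basis : exists n (e : nat -> H),
  [/\ orthonormal_upto n e, forall i, (i < n)%N -> eigenspace (e i) &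
      forall v, eigenspace v -> v = \sum_(i < n) '[< v, e i >] *: e i].
Proof.
have [//|[e [eO eN]]] := orthonormal_basis eigenspace eigenspace0 eigenspace_linear.
exfalso; apply: mu_ess; exists e; split.
- by move=> n; have [] := eN n.
- by move=> n; have [e1 _] := eO n.+1; rewrite nrmE e1.
- exact: bessel_cvg0.
- apply/(@nrm_seqP R R[i]) => d d0; exists 0 => n _.
  by have [_ ->] := eN n; rewrite subrr normr0 subr0 nrm0.
Qed.

Lemma eigenspace_proj u : exists2 v, eigenspace v &
  forall w, eigenspace w -> '[< u - v, w >] = 0.
Proof.
have [n [e [eO eN eB]]] := eigenspace_basis.
have sumN k : (k <= n)%N -> eigenspace (\sum_(i < k) '[< u, e i >] *: e i).
  elim: k => [|k IH] kn; first by rewrite big_ord0; exact: eigenspace0.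
  rewrite big_ord_recr /= addrC; apply: eigenspace_linear; first exact: eN.
  exact/IH/ltnW.
exists (\sum_(i < n) '[< u, e i >] *: e i); first exact: sumN.
move=> w /eB ->.
rewrite (big_morph (fun x => '[< _, x >]) (fun u v => innerDr u v _) (inner0r _)).
rewrite big1// => i _; rewrite innerZr innerBl.
rewrite (inner_sum_orthonormal n e (fun i => '[< u, e i >]))//.
by rewrite subrr mulr0.
Qed.

(** Strong convergence is uniform on a finite-dimensional space: it suffices to
    control finitely many basis vectors. *)
Lemma eigenspace_uniform (s : nat -> {linear H -> H}) :
  (forall u, s n u @[n --> \oo] --> u) ->
  forall eps : R, 0 < eps -> exists N, forall n v, (N <= n)%N -> eigenspace v ->
    nrm (s n v - v) <= eps * nrm v.
Proof.
move=> s_cvg eps eps0.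
have [m [e [[e1 e0] eN eB]]] := eigenspace_basis.
have sum_small k d : 0 < d -> exists N, forall n, (N <= n)%N ->
    \sum_(i < k) nrm (s n (e i) - e i) <= d.
  elim: k d => [|k IH] d d0.
    by exists 0%N => n _; rewrite big_ord0 ltW.
  have h0 : 0 < d / 2 by rewrite divr_gt0.
  have [N1 P1] := IH _ h0.
  have [N2 P2] := (nrm_seqP _ _).1 (s_cvg (e k)) _ h0.
  exists (maxn N1 N2) => n; rewrite geq_max => /andP[/P1 n1 /P2 n2].
  by rewrite big_ord_recr /= nrmB; lra.
have [N NP] := sum_small m eps eps0.
exists N => n v /NP Nn Nv.
have {1 2}-> := eB _ Nv.
rewrite linear_sum -sumrB.
have tri (F : 'I_m -> H) : nrm (\sum_(i < m) F i) <= \sum_(i < m) nrm (F i).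
  elim/big_ind2: _ => //; first by rewrite nrm0.
  by move=> x1 x2 y1 y2 h1 h2; apply: le_trans (nrmD _ _) _; rewrite lerD.
apply: le_trans (tri _) _.
apply: (@le_trans _ _ (\sum_(i < m) nrm v * nrm (s n (e i) - e i))).
  apply: ler_sum => i _; rewrite linearZ /= -scalerBr nrmZ ler_wpM2r ?nrm_ge0//.
  by apply: le_trans (cauchy_schwarz _ _) _; rewrite e1// mulr1.
by rewrite -mulr_sumr mulrC ler_wpM2r// nrm_ge0.
Qed.

End Eigenspace.

(** * Lower bounds for the perturbed operators *)

Section Defect.
Context {R : realType} {H : hilbertType R}.
Variables (T0 : operator H) (S : {linear H -> H}) (gamma : R) (l : R[i]) (u : H).
Hypothesis T0_sa : self_adjoint T0.
Hypothesis S_sym : forall v w, '[< S v, w >] = '[< v, S w >].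
Hypothesis (uT : dom T0 u) (u1 : nrm u = 1).

Let f := T0 u + ('i%C * gamma%:C) *: S u - l *: u.
Let b := complex.Im l.
Let p := complex.Re '[< S u, u >].

Lemma inner_S_real : '[< S u, u >] = p%:C.
Proof.
have := innerC (S u) u; rewrite -S_sym /p; case: '[< _, _ >] => x y /= [] /eqP.
by rewrite -addr_eq0 -mulr2n mulrn_eq0 /= => /eqP ->.
Qed.

(** [T0] contributes nothing to the imaginary part, as it is symmetric. *)
Lemma dissipation : complex.Im '[< f, u >] = gamma * p - b.
Proof.
rewrite /f innerBl innerDl !innerZl inner_S_real inner_nrm u1 expr1n mulr1.
have := sa_Im0 T0 T0_sa u uT; case: '[< T0 u, u >] => x y /= ->.
by rewrite /b; case: l => a c /=; ring.
Qed.

Lemma defect_sqr : nrm (u - S u) ^+ 2 = 1 - 2 * p + nrm (S u) ^+ 2.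
Proof.
have := nrm_subZ u (S u) 1; rewrite scale1r u1 nrm1 expr1n mul1r rmorph1 mul1r => ->.
by rewrite innerC inner_S_real.
Qed.

(** For a projection, [|u - S u|^2 = 1 - <S u, u>], and [dissipation] says how
    close [gamma * <S u, u>] is to [b]. *)
Lemma defect_projection : S (S u) = S u ->
  `|gamma| * nrm (u - S u) ^+ 2 <= `|gamma - b| + nrm f.
Proof.
move=> SS; have Sp : nrm (S u) ^+ 2 = p.
  by rewrite /p -[in RHS]SS S_sym inner_nrm.
have : `|gamma - b - complex.Im '[< f, u >]| <= `|gamma - b| + nrm f.
  apply: le_trans (ler_normB _ _) _; rewrite lerD2l.
  apply: le_trans (Im_le _) _; apply: le_trans (cauchy_schwarz _ _) _.
  by rewrite u1 mulr1.
rewrite dissipation => h; apply: le_trans h.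
rewrite -[X in _ * X]ger0_norm ?exprn_ge0 ?nrm_ge0// -normrM defect_sqr Sp.
by have -> : gamma * (1 - 2 * p + p) = gamma - b - (gamma * p - b) by ring.
Qed.

(** In [|u - S u|^2 = 1 - 2 <S u, u> + |S u|^2], replace [gamma * <S u, u>] by
    [b] using [dissipation], and [gamma * |S u|^2] by [b * <S u, u>] using the
    imaginary part of [<S u, T0 u>]. *)
Lemma defect_commutator (C : R) : nrm (S u) <= C ->
  gamma ^+ 2 * nrm (u - S u) ^+ 2 <= (gamma - b) ^+ 2 +
    nrm f * (2 * `|gamma| + `|b| + `|gamma| * C) +
    `|gamma| * `|complex.Im '[< S u, T0 u >]|.
Proof.
move=> SC.
have fE : T0 u = f + l *: u - ('i%C * gamma%:C) *: S u.
  by rewrite /f subrK addrK.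
have E : complex.Im '[< S u, T0 u >] =
    complex.Im '[< S u, f >] - b * p + gamma * nrm (S u) ^+ 2.
  rewrite fE innerBr innerDr !innerZr inner_S_real inner_nrm /b.
  by case: '[< _, f >] => x y; case: l => a c /=; ring.
have I1 : `|complex.Im '[< S u, f >]| <= nrm f * C.
  apply: le_trans (Im_le _) _; apply: le_trans (cauchy_schwarz _ _) _.
  by rewrite mulrC ler_wpM2l ?nrm_ge0.
have I2 : `|gamma * p - b| <= nrm f.
  rewrite -dissipation; apply: le_trans (Im_le _) _.
  by apply: le_trans (cauchy_schwarz _ _) _; rewrite u1 mulr1.
set x := complex.Im '[< S u, f >] in E I1.
set y := complex.Im '[< S u, T0 u >] in E *.
have -> : gamma ^+ 2 * nrm (u - S u) ^+ 2 = (gamma - b) ^+ 2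
    - 2 * gamma * (gamma * p - b) + b * (gamma * p - b) + gamma * (y - x).
  by rewrite defect_sqr E; ring.
set q := gamma * p - b in I2 *.
have J1 : `|gamma * q| <= `|gamma| * nrm f by rewrite normrM ler_wpM2l.
have J2 : `|b * q| <= `|b| * nrm f by rewrite normrM ler_wpM2l.
have J3 : `|gamma * x| <= `|gamma| * (nrm f * C) by rewrite normrM ler_wpM2l.
have J4 : gamma * y <= `|gamma| * `|y| by rewrite -normrM ler_norm.
move: J1 J2 J3; rewrite !ler_norml => /andP[J1 _] /andP[_ J2] /andP[J3 _].
lra.
Qed.

End Defect.

Section LowerBound.
Context {R : realType} {H : hilbertType R}.
Variables (T0 : operator H) (s : nat -> {linear H -> H}) (mu C : R).
Hypothesis T0_sa : self_adjoint T0.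
Hypothesis s_sym : forall n v w, '[< s n v, w >] = '[< v, s n w >].
Hypothesis s_cvg : forall u : H, s n u @[n --> \oo] --> u.
Hypothesis s_bound : forall n (u : H), nrm (s n u) <= C * nrm u.
Hypothesis mu_ess : ~ essential_spectrum T0 mu%:C.

(** [|(T_n - l) u|]. The adjoint of [T_n - l] is obtained by changing [gamma]
    into [- gamma] and [l] into its conjugate. *)
Definition residual (gamma : R) n (l : R[i]) u :=
  nrm (T0 u + ('i%C * gamma%:C) *: s n u - l *: u).

(** The commutator condition on sequences, restated uniformly so that it can be
    used at a single large index [n]. *)
Definition commutator_small := forall K eta : R, 0 < K -> 0 < eta ->
  exists N, forall n u, (N <= n)%N -> dom T0 u -> nrm u <= K ->
    nrm (T0 u) <= K -> `|complex.Im '[< s n u, T0 u >]| <= eta.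

(** Almost eigenvectors of [T_n], for [l] near [mu + i * gamma], are almost
    fixed by [s_n]. *)
Definition defect_small (gamma : R) := forall a : R, 0 < a ->
  exists r k : R, [/\ 0 < r, 0 < k & exists N, forall n l u, (N <= n)%N ->
    nrm (l - (mu%:C + 'i%C * gamma%:C)) <= r -> dom T0 u -> nrm u = 1 ->
    residual gamma n l u <= k -> nrm (u - s n u) <= a].

Lemma defect_small_projection (gamma : R) : gamma != 0 ->
  (forall n u, s n (s n u) = s n u) -> defect_small gamma.
Proof.
move=> g0 ss a a0; have {}g0 : 0 < `|gamma| by rewrite normr_gt0.
pose r : R := `|gamma| * a ^+ 2 / 2.
have r0 : 0 < r by rewrite !mulr_gt0 ?exprn_gt0 ?invr_gt0.
exists r, r; split => //; exists 0%N => n l u _ lr uT u1 fr.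
rewrite -(ler_pXn2r (ltn0Sn 1)) ?nnegrE ?nrm_ge0 ?(ltW a0)// -(ler_pM2l g0).
apply: le_trans (defect_projection T0 (s n) gamma l u T0_sa (s_sym n) uT u1 (ss n u)) _.
have := Im_le (l - (mu%:C + 'i%C * gamma%:C)).
have -> : complex.Im (l - (mu%:C + 'i%C * gamma%:C)) = complex.Im l - gamma.
  by case: (l) => x y /=; ring.
rewrite distrC; move: fr lr; rewrite /residual /r; lra.
Qed.

Lemma defect_small_commutator (gamma : R) : 0 < C -> gamma != 0 ->
  commutator_small -> defect_small gamma.
Proof.
move=> C0 gn0 comm a a0; have g0 : 0 < `|gamma| by rewrite normr_gt0.
have gC0 : 0 < `|gamma| * C by rewrite mulr_gt0.
(* Each of the three terms of [defect_commutator] is made at most [A / 4]; [D]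
   bounds the factor of the residual in the second one. *)
pose r : R := Num.min 1 (`|gamma| * a / 2).
pose D : R := 3 * `|gamma| + 1 + `|gamma| * C.
have D0 : 0 < D by rewrite /D; lra.
pose A : R := gamma ^+ 2 * a ^+ 2.
have g2 : 0 < gamma ^+ 2 by rewrite exprn_even_gt0.
have A0 : 0 < A by rewrite mulr_gt0// exprn_gt0.
pose k : R := Num.min 1 (A / 4 / D).
have r0 : 0 < r by rewrite lt_min ltr01 !mulr_gt0 ?invr_gt0.
have k0 : 0 < k by rewrite lt_min ltr01 !divr_gt0.
have r1 : r <= 1 by rewrite ge_min lexx.
have r2 : r <= `|gamma| * a / 2 by rewrite ge_min lexx orbT.
have k1 : k <= 1 by rewrite ge_min lexx.
have k2 : k * D <= A / 4 by rewrite -ler_pdivlMr// ge_min lexx orbT.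
exists r, k; split=> //.
pose lam := mu%:C + 'i%C * gamma%:C : R[i].
(* [K] bounds [T0 u], recovered from the residual, [l *: u] and [s n u]. *)
pose K : R := 2 + `|gamma| * C + nrm lam.
have lam0 := nrm_ge0 lam.
have K0 : 0 < K by rewrite /K; lra.
have [N NP] := comm K (`|gamma| * a ^+ 2 / 4) K0 ltac:(by rewrite !mulr_gt0 ?exprn_gt0 ?invr_gt0).
exists N => n l u Nn lr uT u1 fk.
have su : nrm (s n u) <= C by have := s_bound n u; rewrite u1 mulr1.
have ll : nrm l <= nrm lam + 1.
  have := nrmD (l - lam) lam; rewrite subrK => h.
  by move: lr h; rewrite -/lam; lra.
have TK : nrm (T0 u) <= K.
  have -> : T0 u = (T0 u + ('i%C * gamma%:C) *: s n u - l *: u) + l *: u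
      - ('i%C * gamma%:C) *: s n u by rewrite subrK addrK.
  apply: le_trans (nrm_sub _ _) _; rewrite nrmZ nrmM nrm_i mul1r nrm_real.
  have := nrmD (T0 u + ('i%C * gamma%:C) *: s n u - l *: u) (l *: u).
  rewrite nrmZ u1 mulr1; move: fk; rewrite /residual => fk.
  have := ler_wpM2l (ltW g0) su; rewrite /K; lra.
have u1K : nrm u <= K by rewrite u1 /K; lra.
have := NP n u Nn uT u1K TK => comm_n.
have := defect_commutator T0 (s n) gamma l u T0_sa (s_sym n) uT u1 C su.
rewrite -[nrm (_ - l *: u)]/(residual gamma n l u).
have := Im_le (l - lam).
have -> : complex.Im (l - lam) = complex.Im l - gamma.
  by rewrite /lam; case: (l) => x y /=; ring.
set b := complex.Im l => gb def.
have {}gb : `|gamma - b| <= r by rewrite distrC; move: lr; rewrite -/lam; lra.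
have bg : `|b| <= `|gamma| + 1.
  by rewrite distrC in gb; have := ler_normD (b - gamma) gamma; rewrite subrK; lra.
have gb2 : (gamma - b) ^+ 2 <= A / 4.
  have : `|gamma - b| ^+ 2 <= (`|gamma| * a / 2) ^+ 2.
    by rewrite ler_pXn2r ?nnegrE// ?(le_trans gb)// ltW// !mulr_gt0// invr_gt0.
  rewrite real_normK ?num_real// !exprMn real_normK ?num_real// /A; lra.
have f0 : 0 <= residual gamma n l u := nrm_ge0 _.
have fD : residual gamma n l u * (2 * `|gamma| + `|b| + `|gamma| * C) <= A / 4.
  apply: le_trans k2; apply: ler_pM => //; last by rewrite /D; lra.
  by rewrite !addr_ge0// mulr_ge0// ltW.
have comm_g := ler_wpM2l (ltW g0) comm_n.
have gE : `|gamma| * (`|gamma| * a ^+ 2 / 4) = A / 4.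
  by rewrite /A -[in RHS](real_normK (num_real gamma)); ring.
rewrite gE in comm_g.
rewrite -(ler_pXn2r (ltn0Sn 1)) ?nnegrE ?nrm_ge0 ?(ltW a0)//.
rewrite -(ler_pM2l g2) -/A; lra.
Qed.

(** Split a unit vector [w] as [v + (w - v)] with [v] in the eigenspace and
    [w - v] orthogonal to it. If the residual were at most [k], both parts
    would be short: [|v| <= 1/4] by pairing the residual with [v], and
    [|w - v| <= 1/2] by the spectral gap [d], each of the three terms of
    [(T0 - mu) w] being at most [d / 6]. The radius [r] only depends on [d] and
    on the defect, not on [eps]. *)
Lemma lower_bound (gamma : R) : gamma != 0 -> defect_small gamma ->
  exists2 r : R, 0 < r & forall eps : R, 0 < eps ->
  exists2 k : R, 0 < k & exists N, forall n l u, (N <= n)%N ->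
    eps <= nrm (l - (mu%:C + 'i%C * gamma%:C)) ->
    nrm (l - (mu%:C + 'i%C * gamma%:C)) <= r -> dom T0 u ->
    k * nrm u <= residual gamma n l u.
Proof.
move=> gn0 defect; have g0 : 0 < `|gamma| by rewrite normr_gt0.
have [d d0 gap] := eigenspace_gap T0 mu T0_sa mu_ess.
pose a : R := d / (6 * `|gamma|).
have a0 : 0 < a by rewrite divr_gt0// mulr_gt0.
have ga : `|gamma| * a = d / 6 by rewrite /a; field; rewrite gt_eqF.
have [r0 [k0 [r0_gt0 k0_gt0 [N0 defectP]]]] := defect a a0.
pose r : R := Num.min r0 (d / 6); exists r.
  by rewrite lt_min r0_gt0 divr_gt0.
move=> eps eps0; pose k : R := Num.min k0 (Num.min (eps / 8) (d / 6)).
have k_gt0 : 0 < k by rewrite !lt_min k0_gt0 !divr_gt0.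
exists k => //.
have eta0 : 0 < eps / (8 * `|gamma|) by rewrite divr_gt0// mulr_gt0.
have [N1 unifP] := eigenspace_uniform T0 mu mu_ess s s_cvg _ eta0.
exists (maxn N0 N1) => n l u; rewrite geq_max => /andP[nN0 nN1].
pose lam : R[i] := mu%:C + 'i%C * gamma%:C; rewrite -/lam => el lr uT.
have rk0 : k <= k0 by rewrite ge_min lexx.
have rk1 : k <= eps / 8 by rewrite !ge_min lexx ?orbT.
have rk2 : k <= d / 6 by rewrite !ge_min lexx ?orbT.
have lr0 : nrm (l - lam) <= r0 by apply: le_trans lr _; rewrite ge_min lexx.
have lrd : nrm (l - lam) <= d / 6 by apply: le_trans lr _; rewrite ge_min lexx orbT.
have unit_bound w : dom T0 w -> nrm w = 1 -> k < residual gamma n l w.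
  move=> wT w1; rewrite ltNge; apply/negP => fk.
  have dw := defectP n l w nN0 lr0 wT w1 (le_trans fk rk0).
  set f := T0 w + ('i%C * gamma%:C) *: s n w - l *: w.
  have {}fk : nrm f <= k by exact: fk.
  have fE : f = (T0 w - mu%:C *: w) + ('i%C * gamma%:C) *: (s n w - w)
      + (lam - l) *: w.
    rewrite /f scalerBr scalerBl /lam scalerDl.
    by rewrite [X in _ = X + _]addrACA -opprD addrA subrK.
  have [v [vT vE] vO] := eigenspace_proj T0 mu mu_ess w.
  have Nv : eigenspace T0 mu v by [].
  have wv : '[< w, v >] = '[< v, v >].
    by apply/subr0_eq; rewrite -innerBl vO.
  (* [T0 - mu] is symmetric and kills [v], so its term drops out. *)
  have E : (lam - l) * '[< v, v >] =
      '[< f, v >] - ('i%C * gamma%:C) * '[< w, s n v - v >].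
    rewrite fE innerDl innerDl !innerZl shift_sym// vE subrr inner0r add0r wv.
    by rewrite innerBl s_sym innerBr [RHS]addrAC subrr add0r.
  have v_small : nrm v <= 1 / 4.
    have [->|/eqP/nrm_gt0 v0] := eqVneq v 0; first by rewrite nrm0.
    move/(congr1 nrm) : E; rewrite nrmM nrmB inner_nrm nrm_real.
    rewrite ger0_norm ?exprn_ge0 ?nrm_ge0// => E.
    have := nrm_sub '[< f, v >] (('i%C * gamma%:C) * '[< w, s n v - v >]).
    rewrite -E !nrmM nrm_i mul1r nrm_real.
    have := cauchy_schwarz f v; have := cauchy_schwarz w (s n v - v).
    rewrite w1 mul1r => c1 c2 c3.
    have c4 := ler_wpM2l (ltW g0) (le_trans c1 (unifP n v nN1 Nv)).
    have c5 : `|gamma| * (eps / (8 * `|gamma|) * nrm v) = eps / 8 * nrm v.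
      by field; rewrite gt_eqF.
    have c6 := ler_wpM2r (ltW v0) (le_trans fk rk1).
    have c7 : eps * nrm v ^+ 2 <= nrm (l - lam) * nrm v ^+ 2.
      by rewrite ler_wpM2r// exprn_ge0// ltW.
    have : eps * nrm v * nrm v <= eps * (1 / 4) * nrm v.
      rewrite c5 in c4; lra.
    by rewrite ler_pM2r// ler_pM2l.
  have wvT : dom T0 (w - v) by apply: domB.
  have := gap (w - v) wvT vO.
  rewrite shiftB// vE subrr subr0.
  have -> : T0 w - mu%:C *: w = f - (lam - l) *: w
      + ('i%C * gamma%:C) *: (w - s n w).
    by rewrite fE addrK -addrA -scalerDr addrA subrK subrr scaler0 addr0.
  have := nrmD (f - (lam - l) *: w) (('i%C * gamma%:C) *: (w - s n w)).
  have := nrm_sub f ((lam - l) *: w).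
  rewrite !nrmZ nrmM nrm_i mul1r nrm_real w1 mulr1 (nrmB lam).
  have := ler_wpM2l (ltW g0) dw; rewrite ga => h1 h2 h3 h4.
  have : nrm w <= nrm (w - v) + nrm v.
    by have := nrmD (w - v) v; rewrite subrK.
  rewrite w1 => h5.
  have : d * (3 / 4) <= d * nrm (w - v) by rewrite ler_pM2l//; lra.
  lra.
have [->|/eqP/nrm_gt0 u0] := eqVneq u 0; first by rewrite nrm0 mulr0 nrm_ge0.
have := unit_bound ((nrm u)^-1%:C *: u) (domZ _ _ _ uT).
rewrite nrmZ nrm_real gtr0_norm ?invr_gt0// mulVf ?gt_eqF// => /(_ erefl) /ltW.
rewrite /residual opZ// linearZ /= !scalerA mulrC (mulrC l) -!scalerA.
rewrite -scalerDr -scalerBr nrmZ nrm_real gtr0_norm ?invr_gt0//.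
by rewrite mulrC ler_pdivlMr.
Qed.
End LowerBound.

(** * Limits of spectra *)

Lemma infinite_tail (n0 : nat) : infinite_set [set n | (n0 <= n)%N].
Proof.
move=> fin; apply: infinite_nat; apply: (@sub_finite_set _ _ (`I_n0 `|` [set n | (n0 <= n)%N])).
  by move=> n _ /=; case: (ltnP n n0); [left|right].
by rewrite finite_setU; split=> //; exact: finite_II.
Qed.

Lemma infinite_unbounded (I : set nat) N : infinite_set I ->
  exists2 n, I n & (N <= n)%N.
Proof.
move=> Iinf; apply: contrapT => nI; apply: Iinf.
apply: (@sub_finite_set _ _ `I_N); last exact: finite_II.
by move=> n In /=; rewrite ltnNge; apply/negP => Nn; apply: nI; exists n.
Qed.

(** Take for [ln n] a point of the spectrum of [An n] whose distance to [l] is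
    minimal up to [1 / n.+1]. *)
Lemma near_limiting {R : realType} {H : hilbertType R} (An : nat -> operator H)
    (l : R[i]) :
  (forall eps : R, 0 < eps -> exists N, forall n, (N <= n)%N ->
     exists2 l', spectrum (An n) l' & nrm (l - l') <= eps) ->
  limiting_spectrum An l.
Proof.
move=> close; have [n0 n0P] := close 1 ltr01.
pose D n := [set nrm (l - l') | l' in spectrum (An n)].
have Dinf n : (n0 <= n)%N -> has_inf (D n).
  move=> /n0P[l' sl' _]; split; first by exists (nrm (l - l')), l'.
  by exists 0 => _ [m _ <-]; exact: nrm_ge0.
have /choice[ln lnP] : forall n, exists l', (n0 <= n)%N ->
    spectrum (An n) l' /\ nrm (l - l') < inf (D n) + n.+1%:R^-1.
  move=> n; case: (leqP n0 n) => [n0n|]; last by exists 0.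
  have [|_ [l' sl' <-] lt] := @inf_adherent _ (D n) n.+1%:R^-1 _ (Dinf n n0n).
    by rewrite invr_gt0.
  by exists l'.
exists [set n | (n0 <= n)%N]; split; first exact: infinite_tail.
exists ln; split=> [n /lnP[]//|].
apply/nrm_cvgP => e e0; rewrite near_withinE.
have e2 : 0 < e / 2 by rewrite divr_gt0.
have [N1 P1] := close _ e2; have [N2 P2] := invS_small _ e2.
exists (maxn N1 N2) => // n /=; rewrite geq_max => /andP[/P1[l' sl' ll'] /P2 n2] n0n.
apply: lt_le_trans (lnP n n0n).2 _.
have : inf (D n) <= nrm (l - l') by apply: ge_inf; [exact: (Dinf n n0n).2|exists l'].
move: n2; move: (n.+1%:R^-1) => x; lra.
Qed.

Section PerturbedOperator.
Context {R : realType} {H : hilbertType R}.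
Variables (T0 : operator H) (s : nat -> {linear H -> H}).

(** If uniformity failed, vectors that violate it would exist at arbitrarily
    large indices; completing them by 0 at the other indices gives a bounded
    sequence that contradicts the hypothesis. *)
Lemma commutator_small_of_cvg :
  (forall u : nat -> H, (forall n, dom T0 (u n)) ->
     bounded_fun u -> bounded_fun (fun n => T0 (u n)) ->
     '[< s n (u n), T0 (u n) >] - '[< T0 (u n), s n (u n) >] @[n --> \oo]
       --> (0 : R[i])) -> commutator_small T0 s.
Proof.
move=> comm K eta K0 eta0; apply: contrapT => nN.
pose bad n u := [/\ dom T0 u, nrm u <= K, nrm (T0 u) <= K &
  eta < `|complex.Im '[< s n u, T0 u >]|].
have badP N : exists2 n, (N <= n)%N & exists u, bad n u.
  apply: contrapT => nb; apply: nN; exists N => n u Nn uT uK TuK.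
  by rewrite leNgt; apply/negP => etau; apply: nb; exists n => //; exists u.
have /choice[u uP] : forall n, exists u, [/\ dom T0 u, nrm u <= K, nrm (T0 u) <= K &
    (exists u, bad n u) -> eta < `|complex.Im '[< s n u, T0 u >]|].
  move=> n; have [[u [uT uK TK b]]|nb] := pselect (exists u, bad n u).
    by exists u.
  exists 0; split; rewrite ?op0 ?nrm0 ?(ltW K0)//; exact: dom0.
have bnd (f : nat -> H) : (forall n, nrm (f n) <= K) -> bounded_fun f.
  move=> fK; exists K%:C; split; first by rewrite ger0_real// ler0c ltW.
  move=> M KM n _ /=; rewrite nrmE (le_trans _ (ltW KM))// lecR; exact: fK.
have /nrm_seqP/(_ eta eta0)[N NP] := comm u (fun n => let: And4 h _ _ _ := uP n in h)
  (bnd _ (fun n => let: And4 _ h _ _ := uP n in h))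
  (bnd _ (fun n => let: And4 _ _ h _ := uP n in h)).
have [n Nn bn] := badP N; have [_ _ _ /(_ bn)] := uP n; have := NP n Nn.
rewrite sub0r nrmN (innerC (T0 _)) subcJ !nrmM nrm_nat nrm_i nrm_real mulr1.
have := normr_ge0 (complex.Im '[< s n (u n), T0 (u n) >]); lra.
Qed.

Lemma residual_resolvent (C k gamma : R) n l : self_adjoint T0 ->
  (forall n v w, '[< s n v, w >] = '[< v, s n w >]) ->
  (forall n u, nrm (s n u) <= C * nrm u) -> 0 < k ->
  (forall u, dom T0 u -> k * nrm u <= residual T0 s gamma n l u) ->
  (forall u, dom T0 u -> k * nrm u <= residual T0 s (- gamma) n (l^*)%C u) ->
  resolvent_set (op_add T0 (('i%C * gamma%:C) \*: s n)) l.
Proof.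
move=> T0_sa s_sym s_bound k0 kl kl'.
pose S : {linear H -> H} := ('i%C * gamma%:C) \*: s n.
pose S' : {linear H -> H} := ('i%C * (- gamma)%:C) \*: s n.
apply: (perturbed_resolvent T0 S S' (`|gamma| * C) k l T0_sa _ _ k0 kl kl').
- by move=> u /=; rewrite nrmZ nrmM nrm_i mul1r nrm_real -mulrA ler_wpM2l.
- move=> u v /=; rewrite innerZl innerZr s_sym; congr (_ * _).
  by apply/eqP; rewrite eq_complex /=; apply/andP; split; apply/eqP; ring.
Qed.

End PerturbedOperator.

(** * Spectral exactness near an isolated eigenvalue *)

Section Discrete.
Context {R : realType} {H : hilbertType R}.
Variables (T0 : operator H) (gamma : R).
Hypothesis T0_sa : self_adjoint T0.

Lemma idfun_sym (n : nat) (v w : H) : '[< idfun v, w >] = '[< v, idfun w >].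
Proof. by []. Qed.

Lemma idfun_bound (n : nat) (u : H) : nrm (idfun u) <= 1 * nrm u.
Proof. by rewrite mul1r. Qed.

Let T := op_add T0 (('i%C * gamma%:C) \*: idfun).

Lemma shifted_resolvent (k : R) l : 0 < k ->
  (forall u, dom T0 u -> k * nrm u <= residual T0 (fun=> idfun) gamma 0 l u) ->
  (forall u, dom T0 u ->
     k * nrm u <= residual T0 (fun=> idfun) (- gamma) 0 (l^*)%C u) ->
  resolvent_set T l.
Proof.
exact: (residual_resolvent T0 (fun=> idfun) 1 k gamma 0 l T0_sa idfun_sym idfun_bound).
Qed.

Lemma residual_idfun (g : R) l u : residual T0 (fun=> idfun) g 0 l u =
  nrm (T0 u - (l - 'i%C * g%:C) *: u).
Proof. by rewrite /residual /= scalerBl opprB addrA addrAC. Qed.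

Lemma shifted_essential l : ~ essential_spectrum T l ->
  ~ essential_spectrum T0 (l - 'i%C * gamma%:C).
Proof.
move=> ess [u [uT u1 u0 uE]]; apply: ess; exists u; split=> //.
apply: cvg_trans uE; apply: near_eq_cvg; near=> n.
by rewrite /= scalerBl opprB addrA addrAC.
Unshelve. all: by end_near. Qed.

(** [|Im z|] is a lower bound for [T0 - z], since [<T0 u, u>] is real; so [T - l]
    is invertible as soon as [Im l] differs from [gamma]. *)
Lemma spectrum_im l : spectrum T l -> complex.Im l = gamma.
Proof.
move=> sl; apply: contrapT => /eqP lg; apply: sl.
have below (z : R[i]) (c : R) u : `|complex.Im z| = c -> dom T0 u ->
    c * nrm u <= nrm (T0 u - z *: u).
  move=> zc uT; have [->|/eqP/nrm_gt0 u0] := eqVneq u 0; first by rewrite nrm0 mulr0 nrm_ge0.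
  rewrite -(ler_pM2r u0); apply: le_trans (cauchy_schwarz _ _).
  apply: le_trans (Im_le _); rewrite innerBl innerZl inner_nrm.
  have := sa_Im0 T0 T0_sa u uT; case: '[< T0 u, u >] => x y /= ->.
  have -> : complex.Im ((x +i* 0) - z * (nrm u ^+ 2)%:C) = - (complex.Im z * nrm u ^+ 2).
    by case: (z) => p q /=; ring.
  by rewrite normrN normrM zc (ger0_norm (exprn_ge0 _ (nrm_ge0 _))) expr2 mulrA.
apply: (shifted_resolvent `|complex.Im l - gamma|).
- by rewrite normr_gt0 subr_eq0.
- move=> u; rewrite residual_idfun; apply: below; congr (`|_|).
  by case: l lg => p q /= _; ring.
- move=> u; rewrite residual_idfun; apply: below; rewrite -normrN; congr (`|_|).
  by case: l lg => p q /= _; ring.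
Qed.

Lemma discrete_eigenvalue l : discrete_spectrum T l -> exists mu : R,
  [/\ l = mu%:C + 'i%C * gamma%:C, ~ essential_spectrum T0 mu%:C &
      exists2 phi, eigenspace T0 mu phi & nrm phi = 1].
Proof.
move=> [sl /shifted_essential ess].
have lE : l = (complex.Re l)%:C + 'i%C * gamma%:C.
  by rewrite -(spectrum_im _ sl) -complexE.
move: (complex.Re l) lE => mu lE; exists mu.
have {}ess : ~ essential_spectrum T0 mu%:C by move: ess; rewrite lE addrK.
split=> //.
have [phi Nphi phi0] : exists2 phi, eigenspace T0 mu phi & phi <> 0.
  apply: contrapT => nphi; apply: sl.
  have [d d0 gap] := eigenspace_gap T0 mu T0_sa ess.
  have {}gap u : dom T0 u -> d * nrm u <= nrm (T0 u - mu%:C *: u).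
    move=> uT; apply: gap => // v Nv.
    suff -> : v = 0 by rewrite inner0r.
    by apply: contrapT => v0; apply: nphi; exists v.
  apply: (shifted_resolvent d) => // u uT; rewrite residual_idfun.
    by rewrite lE addrK gap.
  have -> : (l^*)%C - 'i%C * (- gamma)%:C = mu%:C; last exact: gap.
  by rewrite lE; apply/eqP; rewrite eq_complex /=; apply/andP; split; apply/eqP; ring.
exists ((nrm phi)^-1%:C *: phi).
  by rewrite -[_ *: _]addr0; apply: eigenspace_linear => //; exact: eigenspace0.
rewrite nrmZ nrm_real gtr0_norm ?invr_gt0 ?mulVf ?gt_eqF//; exact: nrm_gt0.
Qed.

End Discrete.

Section Pencil.
Context {R : realType} {H : hilbertType R}.
Variables (T0 : operator H) (s : nat -> {linear H -> H}) (mu C gamma : R).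
Hypothesis T0_sa : self_adjoint T0.
Hypothesis s_sym : forall n v w, '[< s n v, w >] = '[< v, s n w >].
Hypothesis s_cvg : forall u : H, s n u @[n --> \oo] --> u.
Hypothesis s_bound : forall n (u : H), nrm (s n u) <= C * nrm u.
Hypothesis mu_ess : ~ essential_spectrum T0 mu%:C.
Hypothesis gamma0 : gamma != 0.
Hypothesis defect : forall g : R, g != 0 -> defect_small T0 s mu g.

Let lam := mu%:C + 'i%C * gamma%:C.
Let Tn n := op_add T0 (('i%C * gamma%:C) \*: s n).
Let T := op_add T0 (('i%C * gamma%:C) \*: idfun).

Lemma two_sided_bound : exists2 r : R, 0 < r & forall eps : R, 0 < eps ->
  exists2 k : R, 0 < k & exists N, forall n l, (N <= n)%N ->
    eps <= nrm (l - lam) -> nrm (l - lam) <= r ->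
    (forall u, dom T0 u -> k * nrm u <= residual T0 s gamma n l u) /\
    (forall u, dom T0 u -> k * nrm u <= residual T0 s (- gamma) n (l^*)%C u).
Proof.
have gN0 : - gamma != 0 by rewrite oppr_eq0.
have [r1 r10 P1] := lower_bound T0 s mu T0_sa s_sym s_cvg mu_ess _ gamma0 (defect _ gamma0).
have [r2 r20 P2] := lower_bound T0 s mu T0_sa s_sym s_cvg mu_ess _ gN0 (defect _ gN0).
exists (Num.min r1 r2); first by rewrite lt_min r10.
move=> eps eps0; have [k1 k10 [N1 Q1]] := P1 _ eps0; have [k2 k20 [N2 Q2]] := P2 _ eps0.
exists (Num.min k1 k2); first by rewrite lt_min k10.
exists (maxn N1 N2) => n l; rewrite geq_max => /andP[n1 n2] el.
rewrite le_min => /andP[lr1 lr2]; split=> u uT.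
  apply: le_trans (Q1 n l u n1 el lr1 uT).
  by rewrite ler_wpM2r ?nrm_ge0// ge_min lexx.
have lE : nrm ((l^*)%C - (mu%:C + 'i%C * (- gamma)%:C)) = nrm (l - lam).
  rewrite -[RHS]nrm_conj; congr (nrm _); rewrite /lam.
  by case: l {el lr1 lr2} => x y; apply/eqP; rewrite eq_complex /=;
     apply/andP; split; apply/eqP; ring.
apply: (le_trans _ (Q2 n (l^*)%C u n2 _ _ uT)); rewrite ?lE//.
by rewrite ler_wpM2r ?nrm_ge0// ge_min lexx orbT.
Qed.

(** Lower bounds for [T_n - l] that are uniform in [n] pass to [T - l]. *)
Lemma residual_limit (k g : R) N l u :
  (forall n, (N <= n)%N -> k <= residual T0 s g n l u) ->
  k <= residual T0 (fun=> idfun) g 0 l u.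
Proof.
move=> kn; apply/ler_addgt0Pr => e e0.
have g1 : 0 < 1 + `|g| by rewrite ltr_pwDl.
have [N1 P1] := (nrm_seqP _ _).1 (s_cvg u) _ (divr_gt0 e0 g1).
apply: le_trans (kn _ (leq_maxl N N1)) _.
have {}P1 := P1 _ (leq_maxr N N1); move: (maxn N N1) P1 => n P1; rewrite /residual.
have -> : T0 u + ('i%C * g%:C) *: s n u - l *: u =
    T0 u + ('i%C * g%:C) *: u - l *: u - ('i%C * g%:C) *: (u - s n u).
  rewrite scalerBr opprB [RHS]addrA [RHS]addrAC.
  by rewrite (addrAC (T0 u) (_ *: u)) addrK addrAC.
apply: le_trans (nrm_sub _ _) _; rewrite /= lerD2l nrmZ nrmM nrm_i mul1r nrm_real.
have -> : e = (1 + `|g|) * (e / (1 + `|g|)) by rewrite mulrC divfK// gt_eqF.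
by rewrite ler_pM ?nrm_ge0// ?lerDr// ltW.
Qed.

Lemma exactness_near_eigenvalue phi : eigenspace T0 mu phi -> nrm phi = 1 ->
  spectrum T lam ->
  exists Omega : set R[i], [/\ open Omega, Omega lam & spectrally_exact Tn T Omega].
Proof.
move=> [phiT phiE] phi1 slam; have [r r0 bound] := two_sided_bound.
have Tn_res (eps : R) : 0 < eps -> exists N, forall n l, (N <= n)%N ->
    eps <= nrm (l - lam) -> nrm (l - lam) <= r -> resolvent_set (Tn n) l.
  move=> /bound[k k0 [N NP]]; exists N => n l Nn el lr.
  have [b1 b2] := NP n l Nn el lr.
  exact: (residual_resolvent T0 s C k gamma n l T0_sa s_sym s_bound k0 b1 b2).
have T_res l : nrm (l - lam) <= r -> spectrum T l -> l = lam.
  move=> lr sl; apply/subr0_eq; apply: contrapT => /nrm_gt0 el; apply: sl.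
  have [k k0 [N NP]] := bound _ el.
  apply: (shifted_resolvent T0 gamma T0_sa k) => // u uT.
    by apply: (residual_limit _ _ N) => n Nn; have [b _] := NP n l Nn (lexx _) lr; exact: b.
  by apply: (residual_limit _ _ N) => n Nn; have [_ b] := NP n l Nn (lexx _) lr; exact: b.
have lam_lim : limiting_spectrum Tn lam.
  apply: near_limiting => eps eps0.
  (* On the boundary of the square of half-side [rho], the distance to [lam] is
     between [rho] and [2 * rho], so that [two_sided_bound] applies. *)
  pose rho : R := Num.min eps r / 2.
  have m0 : 0 < Num.min eps r by rewrite lt_min eps0.
  have rho0 : 0 < rho by rewrite divr_gt0.
  have rho_eps : 2 * rho <= eps.
    by rewrite /rho mulrC divfK ?pnatr_eq0// ge_min lexx.
  have rho_r : 2 * rho <= r.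
    by rewrite /rho mulrC divfK ?pnatr_eq0// ge_min lexx orbT.
  have [k k0 [N1 P1]] := bound _ rho0.
  have g0 : 0 < `|gamma| by rewrite normr_gt0.
  have kg : 0 < k / `|gamma| by rewrite divr_gt0.
  have [N2 P2] := (nrm_seqP _ _).1 (s_cvg phi) _ kg.
  exists (maxn N1 N2) => n; rewrite geq_max => /andP[n1 /P2 n2].
  apply: contrapT => no.
  have sq (x y : R) : `|x| <= rho -> `|y| <= rho ->
      nrm (lam + Complex x y - lam) <= 2 * rho.
    move=> xr yr; rewrite addrC addKr; apply: le_trans (nrm_le_ReIm _) _ => /=; lra.
  pose psi := Tn n phi - lam *: phi.
  have psiE : psi = - (('i%C * gamma%:C) *: (phi - s n phi)).
    by rewrite /psi /= phiE /lam scalerDl scalerBr opprB opprD addrACA subrr add0r.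
  have psi_lt : nrm psi < k.
    by rewrite psiE nrmN nrmZ nrmM nrm_i mul1r nrm_real mulrC -ltr_pdivlMr.
  suff : nrm phi <= nrm psi / k by rewrite phi1 ler_pdivlMr// mul1r leNgt psi_lt.
  apply: (resolvent_max_principle (Tn n) psi lam rho _ phi rho0) => //.
    move=> x y xr yr; apply: contrapT => ns; apply: no.
    by exists (lam + Complex x y) => //; rewrite nrmB (le_trans (sq x y xr yr)).
  move=> x y u xr yr xy [uT uE]; rewrite ler_pdivlMr// mulrC -uE.
  have [|bu _] := P1 n (lam + Complex x y) n1 _ (le_trans (sq x y xr yr) rho_r); last exact: bu.
  rewrite addrC addKr.
  by case: xy => <-; [exact: (Re_le (Complex x y))|exact: (Im_le (Complex x y))].
exists [set l | nrm (l - lam) < r]; split.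
- rewrite openE => l /= lr.
  have /nrm_cvgP/(_ (r - nrm (l - lam))) : id @ nbhs l --> l by exact: cvg_id.
  rewrite subr_gt0 => /(_ lr); apply: filterS => t lt /=.
  by have := nrm_tri l t lam; rewrite (nrmB t l); lra.
- by rewrite /= subrr nrm0.
- split=> [l [sl lr]|]; first by rewrite (T_res l (ltW lr) sl).
  apply/seteqP; split=> // l [[[I [Iinf [ln [lnI lnl]]]] sl] /= lr].
  have el : 0 < nrm (l - lam) by apply: nrm_gt0 => /subr0_eq E; apply: sl; rewrite E.
  (* Points at distance less than [d] from [l] are still in an annulus around
     [lam] that [Tn_res] puts in the resolvent set. *)
  pose d : R := Num.min (nrm (l - lam) / 2) (r - nrm (l - lam)).
  have d0 : 0 < d by rewrite lt_min divr_gt0//= subr_gt0.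
  have [N NP] := Tn_res _ (divr_gt0 el (ltr0Sn _ 1)).
  move/nrm_cvgP/(_ d d0) : lnl; rewrite near_withinE => -[N1 _ N1P].
  have [n In] := infinite_unbounded I (maxn N N1) Iinf.
  rewrite geq_max => /andP[Nn N1n].
  have := N1P n N1n In; rewrite lt_min => /andP[d1 d2].
  apply: (lnI n In); apply: NP => //.
    have := nrm_tri (ln n) l lam; lra.
  have := nrm_tri l (ln n) lam; rewrite (nrmB (ln n) l); lra.
Qed.
End Pencil.

Theorem mainTheorem5 (R : realType) (H : hilbertType R) (sepH : separable H)
    (T0 : operator H) (T0_sa : self_adjoint T0)
    (s : nat -> {linear H -> H}) (s_sa : forall n, self_adjoint (everywhere (s n)))
    (s_cvg : forall u : H, s n u @[n --> \oo] --> u)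
    (C : R) (C_gt0 : 0 < C)
    (s_bound : forall n (u : H), `|s n u| <= C%:C * `|u|)
    (gamma : R) (gamma_gt0 : 0 < gamma) :
  let Tn := fun n => op_add T0 (('i%C * gamma%:C) \*: s n) in
  let T := op_add T0 (('i%C * gamma%:C) \*: idfun) in
  (forall n (u : H), s n (s n u) = s n u) \/
  (forall u : nat -> H, (forall n, dom T0 (u n)) ->
     bounded_fun u -> bounded_fun (fun n => T0 (u n)) ->
     '[< s n (u n), T0 (u n) >] - '[< T0 (u n), s n (u n) >] @[n --> \oo]
       --> (0 : R[i])) ->
  forall lambda : R[i], discrete_spectrum T lambda ->
  exists Omega : set R[i],
    [/\ open Omega, Omega lambda & spectrally_exact Tn T Omega].
Proof.
move=> Tn T alt lambda disc.
have [mu [lamE mu_ess [phi Nphi phi1]]] := discrete_eigenvalue T0 gamma T0_sa _ disc.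
have s_sym n v w : '[< s n v, w >] = '[< v, s n w >].
  exact: (sa_sym (everywhere (s n)) (s_sa n) v w I I).
have s_nrm n u : nrm (s n u) <= C * nrm u.
  by rewrite -lecR rmorphM /= -!nrmE; exact: s_bound.
have defect (g : R) : g != 0 -> defect_small T0 s mu g.
  move=> g0; case: alt => [ss|comm].
    exact: defect_small_projection.
  apply: (defect_small_commutator _ _ _ C) => //.
  exact: commutator_small_of_cvg.
have gamma0 : gamma != 0 by rewrite gt_eqF.
have slam := disc.1; rewrite lamE in slam *.
exact: (exactness_near_eigenvalue T0 s mu C gamma T0_sa s_sym s_cvg s_nrm mu_ess
  gamma0 defect phi Nphi phi1 slam).
Qed.
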